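(* Let $\alpha_1,\ldots,\alpha_{r-1},\beta\in\mathbb{C}$ and $\beta_1,\ldots,\beta_{s-1},\gamma\in\mathbb{C}\setminus\mathbb{Z}_{\le 0}$, and let $x\ge 0$. Then the integral representation $$ {}_{r}\Gamma_{s}\left[\begin{array}{r}(\alpha_{1},x;p),\alpha_{2},\ldots,\alpha_{r-1},\beta;\\ \beta_{1},\ldots,\beta_{s-1},\gamma;\end{array} z\right]=\frac{1}{B(\beta,\gamma-\beta)}\int_{0}^{1}t^{\beta-1}(1-t)^{\gamma-\beta-1}\;{}_{r-1}\Gamma_{s-1}\left[\begin{array}{r}(\alpha_{1},x;p),\alpha_{2},\ldots,\alpha_{r-1};\\ \beta_{1},\ldots,\beta_{s-1};\end{array} zt\right]dt$$ holds true under the conditions $$\Re(p)>0;\qquad \Re(\gamma)>\Re(\beta)>0\ \text{ when } p=0 \text{ and } x=0,$$ provided that the series defining the functions involved converge.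
   Context: Generalized incomplete Gamma function: $\Gamma(\nu,x;p):=\int_x^\infty t^{\nu-1}e^{-t-p/t}\,dt$ for $\Re(p)>0$; for $p=0$ the same integral is the ordinary incomplete Gamma function $\Gamma(\nu,x)$. Extended incomplete Pochhammer symbol: $[\lambda;x,p]_\nu:=\Gamma(\lambda+\nu,x;p)/\Gamma(\lambda)$ for $\lambda,\nu\in\mathbb{C}$. Ordinary Pochhammer symbol: $(\lambda)_0=1$, $(\lambda)_n=\lambda(\lambda+1)\cdots(\lambda+n-1)$. $B(\cdot,\cdot)$ is Euler's Beta function. Extended incomplete generalized hypergeometric function with $r$ numerator parameters $\alpha_1,\ldots,\alpha_r\in\mathbb{C}$ and $s$ denominator parameters $\beta_1,\ldots,\beta_s\in\mathbb{C}\setminus\mathbb{Z}_{\le0}$ (provided the series converges): $${}_{r}\Gamma_{s}\left[\begin{array}{r}(\alpha_{1},x;p),\alpha_{2},\ldots,\alpha_{r};\\ \beta_{1},\ldots,\beta_{s};\end{array} z\right]:=\sum_{n=0}^{\infty}\frac{[\alpha_{1};x,p]_{n}(\alpha_{2})_{n}\cdots(\alpha_{r})_{n}}{(\beta_{1})_{n}\cdots(\beta_{s})_{n}}\frac{z^{n}}{n!}.$$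
   Formalization: The condition Re(γ) > Re(β) > 0 is assumed for all admitted p and x, not only when p = 0 and x = 0; without it the integral on the right diverges, e.g. r=2, s=1, α₁=1, x=0, p=1, z=0, β=−1/2, γ=1. *)

(* Defs.v *)
(* Stdlib reals, with Coquelicot's complex numbers, series and improper integrals. *)
From Stdlib Require Import Reals ZArith List.
From Coquelicot Require Import Coquelicot.

Open Scope R_scope.

Definition Cexp (z : C) : C :=
  (exp (Re z) * cos (Im z), exp (Re z) * sin (Im z)).

(* Principal value of t^s; meaningful for t > 0 only. *)
Definition Rcpow (t : R) (s : C) : C := Cexp (s * RtoC (ln t)).

(* Improper integrals; C is a complete normed module over R here. *)
Definition CInt (f : R -> C) (Fa Fb : (R -> Prop) -> Prop) : C :=
  RInt_gen (V := C_R_CompleteNormedModule) f Fa Fb.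

Definition ex_CInt (f : R -> C) (Fa Fb : (R -> Prop) -> Prop) : Prop :=
  ex_RInt_gen (V := C_R_NormedModule) f Fa Fb.

Definition CSeries (a : nat -> C) : C :=
  (Series (fun n => Re (a n)), Series (fun n => Im (a n))).

Definition ex_CSeries (a : nat -> C) : Prop :=
  ex_series (V := C_R_NormedModule) a.

Definition nonpos_int (c : C) : Prop :=
  exists n : nat, c = RtoC (- INR n).

Fixpoint poch (a : C) (n : nat) : C :=
  match n with
  | O => RtoC 1
  | S m => (poch a m * (a + RtoC (INR m)))%C
  end.

Definition poch_list (l : list C) (n : nat) : C :=
  fold_right Cmult (RtoC 1) (map (fun a => poch a n) l).

(* Gamma(nu, x; p); for p = 0 it is the ordinary incomplete Gamma(nu, x).  The
   lower limit is taken as a right limit, so that x = 0 is allowed. *)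
Definition inc_Gamma (nu : C) (x : R) (p : C) : C :=
  CInt (fun t => Rcpow t (nu - RtoC 1) * Cexp (- RtoC t - p / RtoC t))%C
       (at_right x) (Rbar_locally p_infty).

(* Euler's integral where Re z > 0, continued by Gamma(z) = Gamma(z + n) / (z)_n,
   where n is such that Re z + n > 0.  At the poles (z)_n = 0 and Coquelicot's
   / 0 = 0 gives the value 0, whence / Gamma(z) = 0 there, which is the value of
   the entire function 1/Gamma. *)
Definition CGamma (z : C) : C :=
  let n := Z.to_nat (up (- Re z)) in
  (inc_Gamma (z + RtoC (INR n)) 0 (RtoC 0) / poch z n)%C.

(* Euler's integral of the first kind, convergent for Re a > 0 and Re b > 0. *)
Definition CBeta (a b : C) : C :=
  CInt (fun t => Rcpow t (a - RtoC 1) * Rcpow (1 - t) (b - RtoC 1))%C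
       (at_right 0) (at_left 1).

Definition inc_poch (lambda : C) (x : R) (p nu : C) : C :=
  (inc_Gamma (lambda + nu) x p / CGamma lambda)%C.

(* In the next two definitions alphas lists alpha_2, ..., alpha_r and betas lists
   beta_1, ..., beta_s; thus r = S (length alphas) and s = length betas. *)
Definition hyp_term (alpha1 : C) (x : R) (p : C) (alphas betas : list C)
    (z : C) (n : nat) : C :=
  (inc_poch alpha1 x p (RtoC (INR n)) * poch_list alphas n / poch_list betas n
   * (z ^ n / RtoC (INR (fact n))))%C.

Definition hyp_Gamma (alpha1 : C) (x : R) (p : C) (alphas betas : list C)
    (z : C) : C :=
  CSeries (hyp_term alpha1 x p alphas betas z).

(* Main.v *)
Require Import Defs.
From Stdlib Require Import Reals List Factorial Lra Lia.
From Coquelicot Require Import Coquelicot.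

(* The numerator and denominator parameters other than beta and gamma only enter
   through the coefficients b_n of a power series F(t) = sum b_n t^n.  With
   c = gamma - beta, the integral of t^(beta-1) (1-t)^(c-1) F(t) over [v, u] inside
   (0, 1) is sum b_n G_n, where G_n is the integral of t^(beta+n-1) (1-t)^(c-1), and
   G_n -> B(beta + n, c) = B(beta, c) (beta)_n / (gamma)_n as (v, u) -> (0, 1).  As
   sum b_n (beta)_n / (gamma)_n may converge only conditionally, dominated convergence
   is not available; instead, Abel summation applies because the sequence
   r_n = (gamma)_n / (beta)_n G_n has a total variation bounded independently of v, u.
   By r_n - r_(n+1) = (gamma)_n / ((beta)_n (beta + n)) [t^(beta+n) (1-t)^c]_v^u, this
   reduces to real parameters, where the differences at v = 0 are nonnegative and
   telescope. *)

(** The left-hand series is given to converge at z, the right-hand ones only at z t with 0 < t < 1,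
    so 1 may lie on the circle of convergence of F, and uniform convergence is at hand only on
    compact parts of (0, 1). Most facts about the integrals over [v, u] come from one identity, the
    derivative of t^a (1-t)^b. Integrated, it trades (a, b) for (a + 1, b) at the cost of a boundary
    term; this gives convergence at the singular endpoints, uniform bounds and the recurrences of B.
    Passing to real parameters loses only a constant: |t^(i s)| = 1, |(beta)_n| >= (Re beta)_n, and
    |(gamma)_n| <= W (Re gamma)_n with W independent of n. Dividing by B(beta, gamma - beta)
    requires it to be nonzero. For complex parameters the integrand oscillates, so positivity does
    not settle this; the recurrences carry a supposed zero to large parameters, where the
    oscillation becomes negligible. *)

Local Notation CRN := C_R_NormedModule.
Local Notation CRC := C_R_CompleteNormedModule.

(** * Complex powers and the Beta kernel *)

Lemma norm_Cmod (z : C) : norm (K := R_AbsRing) (V := CRN) z = Cmod z.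
Proof.
  unfold norm; simpl; unfold prod_norm, Cmod, norm, abs; simpl.
  f_equal; rewrite !Rmult_1_r, <- !Rabs_mult, !Rabs_pos_eq; nra.
Qed.

Lemma Cexp_plus (a b : C) : Cexp (a + b)%C = (Cexp a * Cexp b)%C.
Proof.
  unfold Cexp, Cmult, Cplus, Re, Im; simpl.
  rewrite exp_plus, cos_plus, sin_plus; f_equal; ring.
Qed.

Lemma Cmod_Cexp (z : C) : Cmod (Cexp z) = exp (Re z).
Proof.
  unfold Cmod, Cexp; simpl.
  replace (_ + _) with (Rsqr (exp (Re z))).
  - apply sqrt_Rsqr, Rlt_le, exp_pos.
  - generalize (sin2_cos2 (Im z)); unfold Rsqr; intros H.
    transitivity (exp (Re z) * exp (Re z) *
      (sin (Im z) * sin (Im z) + cos (Im z) * cos (Im z))); [rewrite H |]; ring.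
Qed.

Lemma Cmod_Rcpow (t : R) (a : C) : Cmod (Rcpow t a) = exp (Re a * ln t).
Proof.
  unfold Rcpow; rewrite Cmod_Cexp; f_equal; unfold Re, Cmult, RtoC; simpl; ring.
Qed.

Lemma Rcpow_plus (t : R) (a b : C) : Rcpow t (a + b)%C = (Rcpow t a * Rcpow t b)%C.
Proof. unfold Rcpow; rewrite <- Cexp_plus; f_equal; ring. Qed.

Lemma Rcpow_RtoC (t r : R) : Rcpow t (RtoC r) = RtoC (exp (r * ln t)).
Proof.
  unfold Rcpow, Cexp, Cmult, RtoC, Re, Im; simpl.
  replace (r * 0 + 0 * ln t) with 0 by ring.
  rewrite cos_0, sin_0; f_equal; try ring.
  replace (r * ln t - 0 * 0) with (r * ln t) by ring; ring.
Qed.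

Lemma Rcpow_1 (t : R) : 0 < t -> Rcpow t (RtoC 1) = RtoC t.
Proof. intros Ht; rewrite Rcpow_RtoC, Rmult_1_l, exp_ln; easy. Qed.

Definition beta_ker (a b : C) (t : R) : C :=
  (Rcpow t (a - RtoC 1) * Rcpow (1 - t) (b - RtoC 1))%C.

Lemma beta_ker_Sl (a b : C) (t : R) :
  0 < t -> beta_ker (a + 1) b t = (RtoC t * beta_ker a b t)%C.
Proof.
  intros Ht; unfold beta_ker.
  replace (a + 1 - 1)%C with ((a - 1) + 1)%C by ring.
  rewrite Rcpow_plus, Rcpow_1 by easy; ring.
Qed.

Lemma beta_ker_Sr (a b : C) (t : R) :
  t < 1 -> beta_ker a (b + 1) t = (RtoC (1 - t) * beta_ker a b t)%C.
Proof.
  intros Ht; unfold beta_ker.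
  replace (b + 1 - 1)%C with ((b - 1) + 1)%C by ring.
  rewrite (Rcpow_plus (1 - t)), (Rcpow_1 (1 - t)) by lra; ring.
Qed.

Lemma beta_ker_nat (a b : C) (t : R) (n : nat) :
  0 < t -> beta_ker (a + INR n) b t = (RtoC (t ^ n) * beta_ker a b t)%C.
Proof.
  intros Ht; induction n as [|n IH].
  - simpl INR; rewrite Cplus_0_r; simpl; ring.
  - rewrite S_INR, RtoC_plus, Cplus_assoc, beta_ker_Sl, IH by easy.
    simpl; rewrite RtoC_mult; ring.
Qed.

Lemma beta_ker_RtoC (a b t : R) :
  beta_ker a b t = RtoC (exp ((a - 1) * ln t + (b - 1) * ln (1 - t))).
Proof.
  unfold beta_ker; rewrite <- !RtoC_minus, !Rcpow_RtoC, <- RtoC_mult, <- exp_plus.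
  easy.
Qed.

(** The imaginary parts of the exponents only rotate. This is what lets the variation bound be
    proved with real parameters. *)
Lemma Cmod_beta_ker (a b : C) (t : R) :
  RtoC (Cmod (beta_ker a b t)) = beta_ker (Re a) (Re b) t.
Proof.
  rewrite beta_ker_RtoC; unfold beta_ker; rewrite Cmod_mult, !Cmod_Rcpow, <- exp_plus.
  easy.
Qed.

Lemma is_derive_C (f : R -> C) (t : R) (l : C) :
  is_derive (fun y => Re (f y)) t (Re l) -> is_derive (fun y => Im (f y)) t (Im l) ->
  is_derive (V := CRN) f t l.
Proof.
  intros H1 H2.
  generalize (is_derive_plus (V := CRN) _ _ t _ _
    (is_derive_scal_l (V := CRN) _ t _ (RtoC 1) H1)
    (is_derive_scal_l (V := CRN) _ t _ Ci H2)).
  intros H.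
  replace l with (plus (G := CRN) (scal (V := CRN) (Re l) (RtoC 1)) (scal (V := CRN) (Im l) Ci)).
  - revert H; apply is_derive_ext; intros y; rewrite !scal_R_Cmult.
    destruct (f y); unfold Re, Im, Ci, RtoC, Cmult, plus; simpl; unfold prod_plus, plus;
      simpl; f_equal; ring.
  - rewrite !scal_R_Cmult.
    destruct l; unfold Re, Im, Ci, RtoC, Cmult, plus; simpl; unfold prod_plus, plus;
      simpl; f_equal; ring.
Qed.

(** The product rule for t^a (1-t)^b, with one factor 1 - t expanded so that both kernels on the
    right carry the same second parameter. Integrated, it becomes a recurrence in [a] alone. *)
Lemma is_derive_beta_ker (a b : C) (t : R) : 0 < t < 1 ->
  is_derive (V := CRN) (beta_ker (a + 1) (b + 1)) t
    (a * beta_ker a b t - (a + b) * beta_ker (a + 1) b t)%C.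
Proof.
  intros Ht.
  (* The logarithmic derivative a / t - b / (1 - t) times the function: a form that can be checked
     on real and imaginary parts. *)
  replace (_ - _)%C with ((a * RtoC (/ t) - b * RtoC (/ (1 - t))) * beta_ker (a + 1) (b + 1) t)%C.
  - unfold beta_ker, Rcpow.
    replace (a + 1 - 1)%C with a by ring; replace (b + 1 - 1)%C with b by ring.
    destruct a as [a1 a2], b as [b1 b2].
    apply is_derive_C;
      unfold Cexp, Cmult, Cplus, Cminus, Copp, RtoC, Re, Im; simpl;
      (auto_derive; [lra |]); unfold Rminus; field; lra.
  - rewrite beta_ker_Sr, beta_ker_Sl by lra.
    rewrite !RtoC_inv by lra.
    rewrite RtoC_minus.
    field; split; [rewrite <- RtoC_minus|]; intros H; apply RtoC_inj in H; lra.
Qed.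

Lemma continuous_beta_ker (a b : C) (t : R) : 0 < t < 1 ->
  continuous (U := CRN) (beta_ker a b) t.
Proof.
  intros Ht; apply (ex_derive_continuous (V := CRN)).
  replace a with ((a - 1) + 1)%C by ring; replace b with ((b - 1) + 1)%C by ring.
  eexists; apply is_derive_beta_ker; easy.
Qed.

Lemma Cmod_beta_ker_le1 (a b : C) (t : R) : 0 <= Re a -> 0 <= Re b -> 0 < t < 1 ->
  Cmod (beta_ker (a + 1) (b + 1) t) <= exp (Re a * ln t) /\
  Cmod (beta_ker (a + 1) (b + 1) t) <= exp (Re b * ln (1 - t)) /\
  Cmod (beta_ker (a + 1) (b + 1) t) <= 1.
Proof.
  intros Ha Hb Ht; unfold beta_ker.
  replace (a + 1 - 1)%C with a by ring; replace (b + 1 - 1)%C with b by ring.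
  rewrite Cmod_mult, !Cmod_Rcpow.
  assert (H1 : ln t < 0) by (rewrite <- ln_1; apply ln_increasing; lra).
  assert (H2 : ln (1 - t) < 0) by (rewrite <- ln_1; apply ln_increasing; lra).
  assert (He : forall y, y <= 0 -> exp y <= 1).
  { intros y [Hy | ->]; [rewrite <- exp_0; left; apply exp_increasing; easy | rewrite exp_0; lra]. }
  assert (H3 : exp (Re a * ln t) <= 1) by (apply He; nra).
  assert (H4 : exp (Re b * ln (1 - t)) <= 1) by (apply He; nra).
  generalize (exp_pos (Re a * ln t)) (exp_pos (Re b * ln (1 - t))); intros; nra.
Qed.

(** * Limits as (v, u) tends to (0, 1) *)

Definition at01 : (R * R -> Prop) -> Prop := filter_prod (at_right 0) (at_left 1).

Definition lim01 (g : R * R -> C) (l : C) : Prop :=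
  forall eps, 0 < eps -> at01 (fun y => Cmod (g y - l) < eps).

#[local] Instance at01_proper : ProperFilter at01.
Proof. apply filter_prod_proper. Qed.

(** The additional bounds by 1/2 put both points inside (0, 1) and ensure v < u. *)
Lemma at01_intro (d : R) (P : R * R -> Prop) : 0 < d ->
  (forall v u, 0 < v < d -> 1 - d < u < 1 -> 0 < v < 1 / 2 -> 1 / 2 < u < 1 -> P (v, u)) ->
  at01 P.
Proof.
  intros Hd H.
  assert (Hd' : 0 < Rmin d (1 / 2)) by (apply Rmin_pos; lra).
  pose proof (Rmin_l d (1 / 2)); pose proof (Rmin_r d (1 / 2)).
  exists (fun v => 0 < v < Rmin d (1 / 2)) (fun u => 1 - Rmin d (1 / 2) < u < 1).
  - exists (mkposreal _ Hd'); intros v Hv Hv0.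
    unfold ball in Hv; simpl in Hv; unfold AbsRing_ball, abs, minus, plus, opp in Hv; simpl in Hv.
    apply Rabs_def2 in Hv; lra.
  - exists (mkposreal _ Hd'); intros v Hv Hv0.
    unfold ball in Hv; simpl in Hv; unfold AbsRing_ball, abs, minus, plus, opp in Hv; simpl in Hv.
    apply Rabs_def2 in Hv; lra.
  - intros v u Hv Hu; apply H; lra.
Qed.

Lemma at01_domain : at01 (fun y => 0 < fst y < 1 / 2 /\ 1 / 2 < snd y < 1).
Proof. apply (at01_intro 1); [lra | simpl; intros; repeat split; lra]. Qed.

Lemma lim01_ext (f g : R * R -> C) (l : C) :
  (forall v u, 0 < v < 1 / 2 -> 1 / 2 < u < 1 -> f (v, u) = g (v, u)) ->
  lim01 f l -> lim01 g l.
Proof.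
  intros H Hf eps Heps.
  generalize (filter_and _ _ at01_domain (Hf eps Heps)); apply filter_imp.
  intros [v u] [[Hv Hu] Hfe]; rewrite <- H; easy.
Qed.

Lemma lim01_plus (f g : R * R -> C) (lf lg : C) :
  lim01 f lf -> lim01 g lg -> lim01 (fun y => f y + g y)%C (lf + lg)%C.
Proof.
  intros Hf Hg eps Heps.
  assert (Heps2 : 0 < eps / 2) by lra.
  generalize (filter_and _ _ (Hf _ Heps2) (Hg _ Heps2)).
  apply filter_imp; intros y [H1 H2].
  replace (f y + g y - (lf + lg))%C with ((f y - lf) + (g y - lg))%C by ring.
  eapply Rle_lt_trans; [apply Cmod_triangle | lra].
Qed.

Lemma lim01_Cmult (c : C) (f : R * R -> C) (l : C) :
  lim01 f l -> lim01 (fun y => c * f y)%C (c * l)%C.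
Proof.
  intros Hf eps Heps.
  pose proof (Cmod_ge_0 c) as Hc.
  assert (He : 0 < eps / (Cmod c + 1)) by (apply Rdiv_lt_0_compat; lra).
  generalize (Hf _ He); apply filter_imp; intros y H.
  replace (c * f y - c * l)%C with (c * (f y - l))%C by ring.
  rewrite Cmod_mult.
  apply Rle_lt_trans with (Cmod c * (eps / (Cmod c + 1))).
  - apply Rmult_le_compat_l; lra.
  - apply Rlt_le_trans with ((Cmod c + 1) * (eps / (Cmod c + 1))).
    + apply Rmult_lt_compat_r; lra.
    + right; field; lra.
Qed.

Lemma exp_mult_ln_lt (r eps : R) : 0 < r -> 0 < eps ->
  exists d, 0 < d /\ forall t, 0 < t < d -> exp (r * ln t) < eps.
Proof.
  (* The threshold is eps^(1/r), the solution of t^r = eps. *)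
  intros Hr Heps; exists (exp (ln eps / r)); split; [apply exp_pos |].
  intros t [Ht Htd].
  rewrite <- (exp_ln eps) by easy; apply exp_increasing.
  apply ln_increasing in Htd; [| easy].
  rewrite ln_exp in Htd.
  apply Rmult_lt_compat_l with (r := r) in Htd; [| easy].
  replace (r * (ln eps / r)) with (ln eps) in Htd by (field; lra); easy.
Qed.

(** The boundary term of the integrated derivative disappears in the limit: the factor t^a is small
    at 0, the factor (1-t)^b at 1, and the other factor is at most 1 in modulus. *)
Lemma lim01_beta_ker (a b : C) : 0 < Re a -> 0 < Re b ->
  lim01 (fun y => beta_ker (a + 1) (b + 1) (snd y) - beta_ker (a + 1) (b + 1) (fst y))%C 0.
Proof.
  intros Ha Hb eps Heps.
  destruct (exp_mult_ln_lt (Re a) (eps / 2) Ha) as (d1 & Hd1 & H1); [lra |].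
  destruct (exp_mult_ln_lt (Re b) (eps / 2) Hb) as (d2 & Hd2 & H2); [lra |].
  apply (at01_intro (Rmin d1 d2)); [apply Rmin_pos; easy |].
  pose proof (Rmin_l d1 d2); pose proof (Rmin_r d1 d2).
  intros v u Hv Hu Hv2 Hu2; simpl.
  destruct (Cmod_beta_ker_le1 a b v) as (E1 & _); try lra.
  destruct (Cmod_beta_ker_le1 a b u) as (_ & E2 & _); try lra.
  specialize (H1 v ltac:(lra)); specialize (H2 (1 - u) ltac:(lra)).
  replace (_ - 0)%C with (beta_ker (a + 1) (b + 1) u + - beta_ker (a + 1) (b + 1) v)%C by ring.
  eapply Rle_lt_trans; [apply Cmod_triangle |]; rewrite Cmod_opp; lra.
Qed.

(** C is a module over R here, so a complex factor is not a scalar; linearity is applied to the real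
    and imaginary parts. *)
Lemma is_RInt_Cmult (c : C) (f : R -> C) (v u : R) (l : C) :
  is_RInt (V := CRN) f v u l -> is_RInt (V := CRN) (fun t => c * f t)%C v u (c * l)%C.
Proof.
  intros H.
  pose proof (is_RInt_fct_extend_fst (U := R_NormedModule) (V := R_NormedModule) _ _ _ _ H) as H1.
  pose proof (is_RInt_fct_extend_snd (U := R_NormedModule) (V := R_NormedModule) _ _ _ _ H) as H2.
  apply (is_RInt_fct_extend_pair (U := R_NormedModule) (V := R_NormedModule)); simpl.
  - apply (is_RInt_minus (V := R_NormedModule)); apply (is_RInt_scal (V := R_NormedModule)); easy.
  - apply (is_RInt_plus (V := R_NormedModule)); apply (is_RInt_scal (V := R_NormedModule)); easy.
Qed.

Lemma continuous_C (f : R -> C) (t : R) :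
  continuous (fun y => Re (f y)) t -> continuous (fun y => Im (f y)) t ->
  continuous (U := CRN) f t.
Proof.
  intros H1 H2.
  apply (continuous_ext (T := R_UniformSpace) (U := CRN)
    (fun y => plus (scal (V := CRN) (Re (f y)) (RtoC 1)) (scal (V := CRN) (Im (f y)) Ci))).
  - intros y; rewrite !scal_R_Cmult.
    destruct (f y); unfold Re, Im, Ci, RtoC, Cmult, plus; simpl; unfold prod_plus, plus;
      simpl; f_equal; ring.
  - apply (continuous_plus (V := CRN)); apply (continuous_scal_l (V := CRN)); easy.
Qed.

Lemma continuous_Re (f : R -> C) (t : R) :
  continuous (U := CRN) f t -> continuous (fun y => Re (f y)) t.
Proof.
  intros H; apply (continuous_comp (U := R_UniformSpace) (V := CRN) f Re); [easy |].
  apply (continuous_fst (U := R_UniformSpace) (V := R_UniformSpace)).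
Qed.

Lemma continuous_Im (f : R -> C) (t : R) :
  continuous (U := CRN) f t -> continuous (fun y => Im (f y)) t.
Proof.
  intros H; apply (continuous_comp (U := R_UniformSpace) (V := CRN) f Im); [easy |].
  apply (continuous_snd (U := R_UniformSpace) (V := R_UniformSpace)).
Qed.

Lemma continuous_Cmult (c : C) (f : R -> C) (t : R) :
  continuous (U := CRN) f t -> continuous (U := CRN) (fun y => c * f y)%C t.
Proof.
  intros H; pose proof (continuous_Re _ _ H) as H1; pose proof (continuous_Im _ _ H) as H2.
  apply continuous_C; simpl.
  - apply (continuous_minus (V := R_NormedModule));
      apply (continuous_scal_r (V := R_NormedModule)); easy.
  - apply (continuous_plus (V := R_NormedModule));
      apply (continuous_scal_r (V := R_NormedModule)); easy.
Qed.

(** The endpoints form a pair so that limits can be taken along [at01]; G_n of the overview is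
    [beta_int (beta + n) c]. *)
Definition beta_int (a b : C) (y : R * R) : C :=
  RInt (V := CRC) (beta_ker a b) (fst y) (snd y).

Lemma is_RInt_beta_ker (a b : C) (v u : R) : 0 < v < 1 -> 0 < u < 1 ->
  is_RInt (V := CRN) (beta_ker a b) v u (beta_int a b (v, u)).
Proof.
  intros Hv Hu; apply (RInt_correct (V := CRC)), (ex_RInt_continuous (V := CRC)).
  intros t Ht; apply continuous_beta_ker.
  revert Ht; unfold Rmin, Rmax; destruct Rle_dec; lra.
Qed.

Lemma beta_int_unique (a b : C) (v u : R) (l : C) :
  is_RInt (V := CRN) (beta_ker a b) v u l -> beta_int a b (v, u) = l.
Proof. apply (is_RInt_unique (V := CRC)). Qed.

(** The fundamental theorem of calculus applied to [is_derive_beta_ker]. In the limit the right side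
    vanishes and the recurrence of B in its first argument remains. *)
Lemma beta_int_Sl (a b : C) (v u : R) : 0 < v < 1 -> 0 < u < 1 ->
  (a * beta_int a b (v, u) - (a + b) * beta_int (a + 1) b (v, u))%C
  = (beta_ker (a + 1) (b + 1) u - beta_ker (a + 1) (b + 1) v)%C.
Proof.
  intros Hv Hu.
  pose proof (is_RInt_minus (V := CRN) _ _ _ _ _ _
    (is_RInt_Cmult a _ _ _ _ (is_RInt_beta_ker a b v u Hv Hu))
    (is_RInt_Cmult (a + b) _ _ _ _ (is_RInt_beta_ker (a + 1) b v u Hv Hu))) as H1.
  apply (is_RInt_unique (V := CRC)) in H1.
  change (RInt (V := CRC) (fun t => a * beta_ker a b t - (a + b) * beta_ker (a + 1) b t)%C v u
    = (a * beta_int a b (v, u) - (a + b) * beta_int (a + 1) b (v, u))%C) in H1.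
  rewrite <- H1; apply (is_RInt_unique (V := CRC)).
  apply (is_RInt_derive (V := CRC)); intros t Ht;
    assert (Ht' : 0 < t < 1) by (revert Ht; unfold Rmin, Rmax; destruct Rle_dec; lra).
  - apply is_derive_beta_ker; easy.
  - apply (continuous_minus (V := CRN)); apply continuous_Cmult, continuous_beta_ker; easy.
Qed.

(** From t + (1 - t) = 1. It transfers the recurrence in [a] to one in [b]. *)
Lemma beta_int_split (a b : C) (v u : R) : 0 < v < 1 -> 0 < u < 1 ->
  beta_int a b (v, u) = (beta_int (a + 1) b (v, u) + beta_int a (b + 1) (v, u))%C.
Proof.
  intros Hv Hu; apply beta_int_unique.
  apply (is_RInt_ext (V := CRN) (fun t => plus (beta_ker (a + 1) b t) (beta_ker a (b + 1) t))).
  - intros t Ht.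
    assert (Ht' : 0 < t < 1) by (revert Ht; unfold Rmin, Rmax; destruct Rle_dec; lra).
    change (beta_ker (a + 1) b t + beta_ker a (b + 1) t = beta_ker a b t)%C.
    rewrite beta_ker_Sl, beta_ker_Sr, RtoC_minus by lra; ring.
  - apply (is_RInt_plus (V := CRN)); apply is_RInt_beta_ker; easy.
Qed.

Lemma beta_int_Sr (a b : C) (v u : R) : 0 < v < 1 -> 0 < u < 1 ->
  (b * beta_int a b (v, u) - (a + b) * beta_int a (b + 1) (v, u))%C
  = (- (beta_ker (a + 1) (b + 1) u - beta_ker (a + 1) (b + 1) v))%C.
Proof.
  intros Hv Hu; rewrite <- beta_int_Sl, (beta_int_split a b v u) by easy; ring.
Qed.

Lemma Re_pos_neq0 (a : C) : 0 < Re a -> a <> 0.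
Proof. intros H ->; simpl in H; lra. Qed.

(** * The Beta integral *)

(** The integrand is at most 1 in modulus. No order of [v] and [u] is imposed, because the Cauchy
    argument compares two lower (or two upper) endpoints in either order. *)
Lemma beta_int_bounded_SS (a b : C) (v u : R) : 0 <= Re a -> 0 <= Re b ->
  0 < v < 1 -> 0 < u < 1 -> Cmod (beta_int (a + 1) (b + 1) (v, u)) <= Rabs (u - v).
Proof.
  intros Ha Hb Hv Hu.
  assert (Hle : forall v u, 0 < v < 1 -> 0 < u < 1 -> v <= u ->
    Cmod (beta_int (a + 1) (b + 1) (v, u)) <= Rabs (u - v)).
  { clear v u Hv Hu; intros v u Hv Hu Hvu.
    rewrite Rabs_pos_eq, <- (Rmult_1_r (u - v)), <- norm_Cmod by lra.
    apply (norm_RInt_le_const (V := CRN) (beta_ker (a + 1) (b + 1)) v u); [easy | |].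
    - intros t Ht; rewrite norm_Cmod; apply Cmod_beta_ker_le1; [easy | easy | lra].
    - apply is_RInt_beta_ker; easy. }
  destruct (Rle_dec v u) as [Hvu | Hvu]; [apply Hle; easy |].
  rewrite Rabs_minus_sym.
  replace (beta_int (a + 1) (b + 1) (v, u)) with (- beta_int (a + 1) (b + 1) (u, v))%C.
  - rewrite Cmod_opp; apply Hle; easy || lra.
  - symmetry; apply beta_int_unique, (is_RInt_swap (V := CRN)), is_RInt_beta_ker; easy.
Qed.

Lemma lim01_beta_int_SS (a b : C) : 0 <= Re a -> 0 <= Re b ->
  exists l, lim01 (beta_int (a + 1) (b + 1)) l.
Proof.
  intros Ha Hb.
  destruct (proj1 (filterlim_locally_cauchy (U := CRC) (F := at01) (beta_int (a + 1) (b + 1))))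
    as [l Hl].
  - intros eps.
    exists (fun y => 0 < fst y < Rmin (eps / 2) (1 / 2) /\ 1 - Rmin (eps / 2) (1 / 2) < snd y < 1).
    pose proof (Rmin_l (eps / 2) (1 / 2)); pose proof (Rmin_r (eps / 2) (1 / 2)).
    pose proof (cond_pos eps) as He.
    split.
    + apply (at01_intro (Rmin (eps / 2) (1 / 2))); [apply Rmin_pos; lra |].
      simpl; intros; repeat split; lra.
    + intros [v u] [v' u']; simpl; intros [Hv Hu] [Hv' Hu'].
      apply (norm_compat1 (V := CRN)); rewrite norm_Cmod.
      change (Cmod (beta_int (a + 1) (b + 1) (v', u') - beta_int (a + 1) (b + 1) (v, u))%C < eps).
      (* Two integrals differ only by the pieces between their lower and between their upper
         endpoints, each of length below eps / 2. *)
      assert (E : (beta_int (a + 1) (b + 1) (v', u')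
        = beta_int (a + 1) (b + 1) (v', v) +
          (beta_int (a + 1) (b + 1) (v, u) + beta_int (a + 1) (b + 1) (u, u')))%C).
      { apply beta_int_unique.
        apply (is_RInt_Chasles (V := CRN) _ _ v _); [apply is_RInt_beta_ker; lra |].
        apply (is_RInt_Chasles (V := CRN) _ _ u _); apply is_RInt_beta_ker; lra. }
      rewrite E.
      replace (_ - _)%C with (beta_int (a + 1) (b + 1) (v', v) + beta_int (a + 1) (b + 1) (u, u'))%C
        by ring.
      eapply Rle_lt_trans; [apply Cmod_triangle |].
      apply Rle_lt_trans with (Rabs (v - v') + Rabs (u' - u)).
      * apply Rplus_le_compat; apply beta_int_bounded_SS; lra.
      * assert (Rabs (v - v') < eps / 2) by (apply Rabs_def1; lra).
        assert (Rabs (u' - u) < eps / 2) by (apply Rabs_def1; lra).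
        lra.
  - exists l; intros eps He.
    pose proof (proj1 (filterlim_locally_ball_norm (K := R_AbsRing) (U := CRN) _ _) Hl
      (mkposreal eps He)) as H.
    revert H; apply filter_imp; intros y; unfold ball_norm; rewrite norm_Cmod; easy.
Qed.

(* The recurrences in a and b reduce convergence to the parameters (a + 1, b + 1),
   where the integrand is bounded by 1. *)
Lemma lim01_beta_int (a b : C) : 0 < Re a -> 0 < Re b ->
  exists l, lim01 (beta_int a b) l.
Proof.
  intros Ha Hb.
  pose proof (Re_pos_neq0 a Ha) as Ha0; pose proof (Re_pos_neq0 b Hb) as Hb0.
  destruct (lim01_beta_int_SS a b) as [l Hl]; [lra | lra |].
  assert (Hab : exists l', lim01 (beta_int (a + 1) b) l').
  { eexists; eapply lim01_ext; [| apply (lim01_Cmult (/ b)), lim01_plus;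
      [apply (lim01_Cmult (-1)), (lim01_beta_ker (a + 1) b) | apply (lim01_Cmult (a + 1 + b)), Hl]];
      [| unfold Re in *; simpl in *; lra | easy].
    intros v u Hv Hu; cbv beta; simpl fst; simpl snd.
    pose proof (beta_int_Sr (a + 1) b v u) as E.
    replace (-1 * (beta_ker (a + 1 + 1) (b + 1) u - beta_ker (a + 1 + 1) (b + 1) v))%C
      with (b * beta_int (a + 1) b (v, u) - (a + 1 + b) * beta_int (a + 1) (b + 1) (v, u))%C.
    - field; easy.
    - rewrite E by lra; ring. }
  destruct Hab as [l' Hl'].
  eexists; eapply lim01_ext; [| apply (lim01_Cmult (/ a)), lim01_plus;
    [apply (lim01_beta_ker a b) | apply (lim01_Cmult (a + b)), Hl']]; [| easy | easy].
  intros v u Hv Hu; cbv beta; simpl fst; simpl snd.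
  rewrite <- (beta_int_Sl a b v u) by lra; field; easy.
Qed.

Lemma lim01_is_RInt_gen (f : R -> C) (g : R * R -> C) (l : C) :
  (forall v u, 0 < v < 1 -> 0 < u < 1 -> is_RInt (V := CRN) f v u (g (v, u))) ->
  lim01 g l -> is_RInt_gen (V := CRN) f (at_right 0) (at_left 1) l.
Proof.
  intros Hf Hg P HP.
  apply (locally_norm_le_locally (V := CRN)) in HP.
  destruct HP as [eps HP].
  change (at01 (fun y => exists z, is_RInt (V := CRN) f (fst y) (snd y) z /\ P z)).
  generalize (filter_and _ _ at01_domain (Hg eps (cond_pos eps))); apply filter_imp.
  intros [v u] [[Hv Hu] H]; simpl in *; exists (g (v, u)); split.
  - apply Hf; lra.
  - apply HP; unfold ball_norm; rewrite norm_Cmod; easy.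
Qed.

Lemma lim01_CInt (f : R -> C) (g : R * R -> C) (l : C) :
  (forall v u, 0 < v < 1 -> 0 < u < 1 -> is_RInt (V := CRN) f v u (g (v, u))) ->
  lim01 g l -> CInt f (at_right 0) (at_left 1) = l.
Proof.
  intros Hf Hg.
  apply (is_RInt_gen_unique (V := CRC)), (lim01_is_RInt_gen f g); easy.
Qed.

Lemma lim01_CBeta (a b : C) : 0 < Re a -> 0 < Re b -> lim01 (beta_int a b) (CBeta a b).
Proof.
  intros Ha Hb; destruct (lim01_beta_int a b Ha Hb) as [l Hl].
  replace (CBeta a b) with l; [easy |].
  symmetry; apply (lim01_CInt (beta_ker a b) (beta_int a b)); [apply is_RInt_beta_ker | easy].
Qed.

Lemma lim01_unique (g : R * R -> C) (l l' : C) : lim01 g l -> lim01 g l' -> l = l'.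
Proof.
  intros H H'; apply (filterlim_locally_unique (K := R_AbsRing) (V := CRN) (F := at01) g);
    apply (filterlim_locally_ball_norm (K := R_AbsRing) (U := CRN)); intros eps;
    [generalize (H eps (cond_pos eps)) | generalize (H' eps (cond_pos eps))];
    apply filter_imp; intros y; unfold ball_norm; rewrite norm_Cmod; easy.
Qed.

Lemma CBeta_Sl (a b : C) : 0 < Re a -> 0 < Re b ->
  (a * CBeta a b = (a + b) * CBeta (a + 1) b)%C.
Proof.
  intros Ha Hb.
  apply (lim01_unique (fun y => a * beta_int a b y)%C).
  - apply lim01_Cmult, lim01_CBeta; easy.
  - replace ((a + b) * CBeta (a + 1) b)%C with (0 + (a + b) * CBeta (a + 1) b)%C by ring.
    eapply lim01_ext; [| apply lim01_plus;
      [apply (lim01_beta_ker a b) | apply (lim01_Cmult (a + b)), lim01_CBeta]]; try easy.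
    + intros v u Hv Hu; cbv beta; simpl fst; simpl snd.
      rewrite <- (beta_int_Sl a b v u) by lra; ring.
    + unfold Re in *; simpl in *; lra.
Qed.

Lemma CBeta_Sr (a b : C) : 0 < Re a -> 0 < Re b ->
  (b * CBeta a b = (a + b) * CBeta a (b + 1))%C.
Proof.
  intros Ha Hb.
  assert (E : CBeta a b = (CBeta (a + 1) b + CBeta a (b + 1))%C).
  { apply (lim01_unique (beta_int a b)); [apply lim01_CBeta; easy |].
    eapply lim01_ext; [| apply lim01_plus; apply lim01_CBeta]; unfold Re in *; simpl in *; try lra.
    intros v u Hv Hu; rewrite (beta_int_split a b) by lra; easy. }
  pose proof (CBeta_Sl a b Ha Hb) as H.
  replace (b * CBeta a b)%C with ((a + b) * CBeta a b - a * CBeta a b)%C by ring.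
  rewrite H, E; ring.
Qed.

(** The same two recurrences as for convergence, now with boundary terms at most 2 uniformly in (v,
    u). The bound serves r_0 in the Abel summation and the telescoped sum of the variation. *)
Lemma beta_int_bounded (a b : C) : 0 < Re a -> 0 < Re b ->
  exists K, forall v u, 0 < v < 1 -> 0 < u < 1 -> Cmod (beta_int a b (v, u)) <= K.
Proof.
  intros Ha Hb.
  pose proof (Re_pos_neq0 a Ha) as Ha0; pose proof (Re_pos_neq0 b Hb) as Hb0.
  assert (Hk : forall a b v u, 0 < Re a -> 0 < Re b -> 0 < v < 1 -> 0 < u < 1 ->
    Cmod (beta_ker (a + 1) (b + 1) u - beta_ker (a + 1) (b + 1) v) <= 2).
  { clear; intros a b v u Ha Hb Hv Hu.
    destruct (Cmod_beta_ker_le1 a b v) as (_ & _ & E1); try lra.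
    destruct (Cmod_beta_ker_le1 a b u) as (_ & _ & E2); try lra.
    eapply Rle_trans; [apply Cmod_triangle |]; rewrite Cmod_opp; lra. }
  assert (H1 : exists K, forall v u, 0 < v < 1 -> 0 < u < 1 ->
    Cmod (beta_int (a + 1) b (v, u)) <= K).
  { exists (Cmod (/ b) * (2 + Cmod (a + 1 + b) * 1)); intros v u Hv Hu.
    replace (beta_int (a + 1) b (v, u)) with
      (/ b * (- (beta_ker (a + 1 + 1) (b + 1) u - beta_ker (a + 1 + 1) (b + 1) v)
        + (a + 1 + b) * beta_int (a + 1) (b + 1) (v, u)))%C.
    - rewrite Cmod_mult; apply Rmult_le_compat_l; [apply Cmod_ge_0 |].
      eapply Rle_trans; [apply Cmod_triangle |]; rewrite Cmod_opp, Cmod_mult.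
      apply Rplus_le_compat; [apply Hk; unfold Re in *; simpl in *; lra |].
      apply Rmult_le_compat_l; [apply Cmod_ge_0 |].
      eapply Rle_trans; [apply beta_int_bounded_SS; lra |].
      apply Rabs_le; lra.
    - rewrite <- beta_int_Sr by easy; field; easy. }
  destruct H1 as [K HK].
  exists (Cmod (/ a) * (2 + Cmod (a + b) * K)); intros v u Hv Hu.
  replace (beta_int a b (v, u)) with
    (/ a * ((beta_ker (a + 1) (b + 1) u - beta_ker (a + 1) (b + 1) v)
      + (a + b) * beta_int (a + 1) b (v, u)))%C.
  - rewrite Cmod_mult; apply Rmult_le_compat_l; [apply Cmod_ge_0 |].
    eapply Rle_trans; [apply Cmod_triangle |]; rewrite Cmod_mult.
    apply Rplus_le_compat; [apply Hk; easy |].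
    apply Rmult_le_compat_l; [apply Cmod_ge_0 | apply HK; easy].
  - rewrite <- beta_int_Sl by easy; field; easy.
Qed.

(** * Nonvanishing of the Beta function *)

Lemma lim01_Re_ge (g : R * R -> C) (l : C) (m : R) :
  lim01 g l -> at01 (fun y => m <= Re (g y)) -> m <= Re l.
Proof.
  intros Hl Hm; apply Rnot_lt_le; intros Hlt.
  assert (He : 0 < m - Re l) by lra.
  destruct (filter_ex _ (filter_and _ _ Hm (Hl _ He))) as [y [H1 H2]].
  pose proof (Rmax_Cmod (g y - l)%C) as H.
  pose proof (Rmax_l (Rabs (fst (g y - l)%C)) (Rabs (snd (g y - l)%C))) as H'.
  pose proof (Rle_abs (fst (g y - l)%C)) as H''.
  unfold Re in *; simpl in *; lra.
Qed.

Lemma is_RInt_Re (f : R -> C) (v u : R) (l : C) :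
  is_RInt (V := CRN) f v u l -> is_RInt (fun t => Re (f t)) v u (Re l).
Proof. apply (is_RInt_fct_extend_fst (U := R_NormedModule) (V := R_NormedModule)). Qed.

Lemma is_RInt_Re_ge0 (f : R -> C) (v u : R) (l : C) : v <= u ->
  is_RInt (V := CRN) f v u l -> (forall t, v < t < u -> 0 <= Re (f t)) -> 0 <= Re l.
Proof.
  intros Hvu Hf H.
  replace 0 with (scal (V := R_NormedModule) (u - v) 0) by apply Rmult_0_r.
  apply (is_RInt_le (fun _ => 0) (fun t => Re (f t)) v u); [easy | | | easy].
  - apply (is_RInt_const (V := R_NormedModule)).
  - apply is_RInt_Re; easy.
Qed.

Lemma Re_beta_ker_pos (a b t : R) : 0 < Re (beta_ker a b t).
Proof. rewrite beta_ker_RtoC; apply exp_pos. Qed.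

(** A limit of positive numbers might be 0; the fixed piece [1/3, 2/3] supplies a positive lower
    bound independent of (v, u). *)
Lemma CBeta_pos (a b : R) : 0 < a -> 0 < b -> 0 < Re (CBeta a b).
Proof.
  intros Ha Hb.
  apply Rlt_le_trans with (Re (beta_int a b (1 / 3, 2 / 3))).
  - erewrite <- (is_RInt_unique (fun t => Re (beta_ker a b t)));
      [| apply is_RInt_Re, is_RInt_beta_ker; lra].
    apply RInt_gt_0; [lra | intros; apply Re_beta_ker_pos |].
    intros t Ht; apply continuous_Re, continuous_beta_ker; lra.
  - apply (lim01_Re_ge (beta_int a b)); [apply lim01_CBeta; easy |].
    apply (at01_intro (1 / 3)); [lra |]; intros v u Hv Hu Hv2 Hu2.
    assert (E : (beta_int a b (v, u) = beta_int a b (v, (1 / 3)%R) +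
      (beta_int a b ((1 / 3)%R, (2 / 3)%R) + beta_int a b ((2 / 3)%R, u)))%C).
    { apply beta_int_unique.
      apply (is_RInt_Chasles (V := CRN) _ _ (1 / 3) _); [apply is_RInt_beta_ker; lra |].
      apply (is_RInt_Chasles (V := CRN) _ _ (2 / 3) _); apply is_RInt_beta_ker; lra. }
    rewrite E.
    assert (0 <= Re (beta_int a b (v, 1 / 3))).
    { apply (is_RInt_Re_ge0 (beta_ker a b) v (1 / 3)); [lra | apply is_RInt_beta_ker; lra |].
      intros; left; apply Re_beta_ker_pos. }
    assert (0 <= Re (beta_int a b (2 / 3, u))).
    { apply (is_RInt_Re_ge0 (beta_ker a b) (2 / 3) u); [lra | apply is_RInt_beta_ker; lra |].
      intros; left; apply Re_beta_ker_pos. }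
    unfold Re in *; simpl in *; lra.
Qed.

Lemma beta_ker_polar (a b : C) (t : R) :
  beta_ker a b t = (beta_ker (Re a) (Re b) t * Cexp (0, (Im a * ln t + Im b * ln (1 - t))%R))%C.
Proof.
  unfold beta_ker, Rcpow; rewrite <- !Cexp_plus; f_equal.
  destruct a, b; unfold Cmult, Cplus, Cminus, Copp, RtoC, Re, Im; simpl; f_equal; ring.
Qed.

(** Near 1/2 the phase is close to its value there and the cosine is at least 1/2; farther away the
    penalty K (t - 1/2)^2 pushes the bound below -1. The square is written 1/4 - t (1-t) because
    multiplication by t (1-t) just raises both Beta parameters by 1. *)
Lemma cos_phase_ge (p q : R) : exists K, 0 <= K /\ forall t, 0 < t < 1 ->
  1 / 2 - K * (1 / 4 - t * (1 - t))
  <= cos (p * ln t + q * ln (1 - t) - (p * ln (1 / 2) + q * ln (1 / 2))).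
Proof.
  set (f := fun t => cos (p * ln t + q * ln (1 - t) - (p * ln (1 / 2) + q * ln (1 / 2)))).
  assert (Hc : continuous f (1 / 2)).
  { apply (ex_derive_continuous (V := R_NormedModule)); unfold f; auto_derive; repeat split; lra. }
  assert (H1 : f (1 / 2) = 1).
  { unfold f; replace (1 - 1 / 2) with (1 / 2) by lra.
    rewrite Rminus_diag; apply cos_0. }
  assert (Hh : 0 < 1 / 2) by lra.
  destruct (proj1 (filterlim_locally _ _) Hc (mkposreal _ Hh)) as [d Hd].
  pose proof (cond_pos d) as Hd0.
  (* At distance at least [d] from 1/2 the penalty is at least 3/2, and 1/2 - 3/2 = -1 bounds every
     cosine. *)
  exists (3 / 2 / (d * d)); split; [apply Rlt_le, Rdiv_lt_0_compat; nra |].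
  intros t Ht; change (1 / 2 - 3 / 2 / (d * d) * (1 / 4 - t * (1 - t)) <= f t).
  assert (HK : 0 < 3 / 2 / (d * d)) by (apply Rdiv_lt_0_compat; nra).
  destruct (Rlt_dec (Rabs (t - 1 / 2)) d) as [Htd | Htd].
  - specialize (Hd t Htd); rewrite H1 in Hd.
    unfold ball in Hd; simpl in Hd; unfold AbsRing_ball, abs, minus, plus, opp in Hd; simpl in Hd.
    apply Rabs_def2 in Hd.
    assert (Hsq : 0 <= 1 / 4 - t * (1 - t)).
    { replace (1 / 4 - t * (1 - t)) with (Rsqr (t - 1 / 2)) by (unfold Rsqr; field).
      apply Rle_0_sqr. }
    apply Rmult_le_compat_l with (r := 3 / 2 / (d * d)) in Hsq; lra.
  - assert (Hs : d * d <= 1 / 4 - t * (1 - t)).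
    { replace (1 / 4 - t * (1 - t)) with (Rsqr (Rabs (t - 1 / 2)))
        by (rewrite <- Rsqr_abs; unfold Rsqr; field).
      unfold Rsqr; apply Rmult_le_compat; lra. }
    apply Rmult_le_compat_l with (r := 3 / 2 / (d * d)) in Hs; [| lra].
    replace (3 / 2 / (d * d) * (d * d)) with (3 / 2) in Hs by (field; lra).
    generalize (COS_bound (p * ln t + q * ln (1 - t) - (p * ln (1 / 2) + q * ln (1 / 2)))).
    fold (f t); lra.
Qed.

(** The bound of [cos_phase_ge] integrated against the real kernel, after a rotation by the phase at
    1/2. The order of quantifiers matters: [c] and [K] depend on the imaginary parts only, so the
    real parts may later grow. *)
Lemma CBeta_phase_ge (p q : R) : exists (c : C) (K : R), 0 <= K /\
  forall a b, 0 < a -> 0 < b ->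
  (1 / 2 - K / 4) * Re (CBeta a b) + K * Re (CBeta (a + 1) (b + 1))
  <= Re (c * CBeta (a, p) (b, q)).
Proof.
  destruct (cos_phase_ge p q) as (K & HK & Hcos).
  set (phi0 := p * ln (1 / 2) + q * ln (1 / 2)) in Hcos.
  exists (Cexp (0, (- phi0)%R)), K; split; [easy |]; intros a b Ha Hb.
  set (c := Cexp (0, (- phi0)%R)).
  (* [G] and its limit [l] are the right side minus the left side, so that only the sign of a single
     integrand is at issue. *)
  set (G := fun y : R * R => (c * beta_int (a, p) (b, q) y
    + (RtoC (K / 4 - 1 / 2) * beta_int a b y + RtoC (- K) * beta_int (a + 1) (b + 1) y))%C).
  set (l := (c * CBeta (a, p) (b, q)
    + (RtoC (K / 4 - 1 / 2) * CBeta a b + RtoC (- K) * CBeta (a + 1) (b + 1)))%C).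
  assert (Hl : lim01 G l).
  { apply lim01_plus; [| apply lim01_plus]; apply lim01_Cmult, lim01_CBeta;
      unfold Re; simpl; lra. }
  assert (H0 : 0 <= Re l).
  { apply (lim01_Re_ge G); [easy |].
    apply (at01_intro 1); [lra |]; intros v u _ _ Hv Hu.
    apply (is_RInt_Re_ge0 (fun t => c * beta_ker (a, p) (b, q) t
      + (RtoC (K / 4 - 1 / 2) * beta_ker a b t + RtoC (- K) * beta_ker (a + 1) (b + 1) t))%C v u);
      [lra | |].
    - apply (is_RInt_plus (V := CRN)); [| apply (is_RInt_plus (V := CRN))];
        apply is_RInt_Cmult, is_RInt_beta_ker; lra.
    - intros t Ht.
      rewrite (beta_ker_polar (a, p)), beta_ker_Sr, beta_ker_Sl by lra; unfold c.
      simpl (Re (_, _)); simpl (Im (_, _)).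
      rewrite beta_ker_RtoC.
      pose proof (exp_pos ((a - 1) * ln t + (b - 1) * ln (1 - t))) as Hk.
      set (k := exp ((a - 1) * ln t + (b - 1) * ln (1 - t))) in *.
      specialize (Hcos t ltac:(lra)).
      set (phi := p * ln t + q * ln (1 - t)) in *.
      replace (_ + _)%C with (RtoC k * (Cexp (0, (- phi0)%R) * Cexp (0, phi)
        + RtoC (K / 4 - 1 / 2 - K * (t * (1 - t)))))%C.
      + rewrite <- Cexp_plus.
        replace ((0, (- phi0)%R) + (0, phi))%C with ((0, (phi - phi0)%R) : C)
          by (unfold Cplus; simpl; f_equal; ring).
        unfold Cexp, RtoC, Cmult, Cplus, Re, Im; simpl; rewrite exp_0.
        match goal with |- 0 <= ?e =>
          replace e with (k * (cos (phi - phi0) + (K / 4 - 1 / 2 - K * (t * (1 - t))))) by ring end.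
        apply Rmult_le_pos; lra.
      + unfold Cexp, RtoC, Cmult, Cplus, Re, Im; simpl; f_equal; ring. }
  unfold l in H0; clear - H0; unfold Re in *; simpl in *; lra.
Qed.

(** For real parameters the factor is the mean of t (1-t) under the Beta weight. *)
Lemma CBeta_SS (a b : C) : 0 < Re a -> 0 < Re b ->
  CBeta (a + 1) (b + 1) = (a * b / ((a + b) * (a + b + 1)) * CBeta a b)%C.
Proof.
  intros Ha Hb.
  pose proof (CBeta_Sl a b Ha Hb) as H1.
  assert (H2 : (b * CBeta (a + 1) b = (a + 1 + b) * CBeta (a + 1) (b + 1))%C).
  { apply CBeta_Sr; unfold Re in *; simpl in *; lra. }
  assert (N1 : (a + b)%C <> 0) by (apply Re_pos_neq0; unfold Re in *; simpl in *; lra).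
  assert (N2 : (a + b + 1)%C <> 0) by (apply Re_pos_neq0; unfold Re in *; simpl in *; lra).
  replace (a * b / ((a + b) * (a + b + 1)) * CBeta a b)%C
    with (b / ((a + b) * (a + b + 1)) * (a * CBeta a b))%C by (field; easy).
  rewrite H1.
  replace (b / ((a + b) * (a + b + 1)) * ((a + b) * CBeta (a + 1) b))%C
    with (/ (a + b + 1) * (b * CBeta (a + 1) b))%C by (field; easy).
  rewrite H2; replace (a + 1 + b)%C with (a + b + 1)%C by ring; field; easy.
Qed.

(* If B(a, b) = 0, then B(a + n, b + n) = 0 for all n.  But the weight
   t^(a+n-1) (1-t)^(b+n-1) concentrates at t = 1/2, where its phase is nearly constant:
   its mean of (t - 1/2)^2 = 1/4 - t (1-t) tends to 0. *)
Lemma CBeta_neq0 (a b : C) : 0 < Re a -> 0 < Re b -> CBeta a b <> 0.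
Proof.
  intros Ha Hb H0.
  assert (Hn : forall n, CBeta (a + INR n) (b + INR n) = 0).
  { induction n as [|n IH]; [simpl; rewrite !Cplus_0_r; easy |].
    rewrite S_INR, RtoC_plus, !Cplus_assoc, CBeta_SS, IH; [ring | |];
      pose proof (pos_INR n); unfold Re in *; simpl in *; lra. }
  destruct (CBeta_phase_ge (Im a) (Im b)) as (c & K & HK & H).
  set (D := Re a - Re b).
  (* With s = x + y one has 1/4 - r = (D^2 + s) / (4 s (s + 1)), where [D] does not change with [n].
     Once s exceeds D^2 and K, K (1/4 - r) <= K / (2 (s + 1)) < 1/2, which contradicts the phase
     inequality with a zero right side. *)
  destruct (INR_unbounded (D * D + K + 1)) as [n HnN].
  pose proof (pos_INR n) as Hn0.
  set (x := Re a + INR n) in *; set (y := Re b + INR n) in *.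
  assert (Hx : INR n < x) by (unfold x; lra).
  assert (Hy : INR n < y) by (unfold y; lra).
  assert (HD : D = x - y) by (unfold D, x, y; ring).
  specialize (H x y ltac:(lra) ltac:(lra)).
  replace ((x, Im a) : C) with (a + INR n)%C in H
    by (unfold x; destruct a; unfold Cplus, RtoC, Re, Im; simpl; f_equal; ring).
  replace ((y, Im b) : C) with (b + INR n)%C in H
    by (unfold y; destruct b; unfold Cplus, RtoC, Re, Im; simpl; f_equal; ring).
  rewrite Hn, Cmult_0_r in H; simpl (Re 0) in H.
  pose proof (CBeta_pos x y ltac:(lra) ltac:(lra)) as Hpos.
  rewrite CBeta_SS in H by (simpl; lra).
  replace (x * y / ((x + y) * (x + y + 1)))%C with (RtoC (x * y / ((x + y) * (x + y + 1)))) in H.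
  2:{ rewrite RtoC_div, !RtoC_mult, !RtoC_plus by nra; easy. }
  rewrite re_scal_l in H.
  set (X := Re (CBeta x y)) in *.
  set (r := x * y / ((x + y) * (x + y + 1))) in *.
  assert (Hr : K * (1 / 4 - r) < 1 / 2).
  { assert (Hq : 0 < (x + y) * (x + y + 1)) by nra.
    replace (K * (1 / 4 - r)) with (K * (D * D + (x + y)) / (4 * ((x + y) * (x + y + 1)))).
    - apply Rlt_div_l; [lra |].
      assert (HDD : 0 <= D * D) by nra.
      apply Rle_lt_trans with (K * (2 * (x + y))); [apply Rmult_le_compat_l; lra |].
      nra.
    - rewrite HD; unfold r; field; nra. }
  nra.
Qed.

(** * Abel summation *)

Fixpoint csum (a : nat -> C) (n : nat) : C :=
  match n with
  | O => RtoC 0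
  | S m => (csum a m + a m)%C
  end.

Fixpoint rsum (a : nat -> R) (n : nat) : R :=
  match n with
  | O => 0
  | S m => rsum a m + a m
  end.

Definition csum_lim (a : nat -> C) (l : C) : Prop :=
  forall eps, 0 < eps -> exists N, forall n, (N <= n)%nat -> Cmod (csum a n - l) < eps.

Lemma rsum_le (a b : nat -> R) (n : nat) :
  (forall k, a k <= b k) -> rsum a n <= rsum b n.
Proof. intros H; induction n as [|n IH]; simpl; [lra | specialize (H n); lra]. Qed.

Lemma rsum_plus (a b : nat -> R) (n : nat) :
  rsum (fun k => a k + b k) n = rsum a n + rsum b n.
Proof. induction n as [|n IH]; simpl; lra. Qed.

Lemma rsum_scal (c : R) (a : nat -> R) (n : nat) :
  rsum (fun k => c * a k) n = c * rsum a n.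
Proof. induction n as [|n IH]; simpl; [ring | rewrite IH; ring]. Qed.

Lemma Cmod_csum (a : nat -> C) (n : nat) :
  Cmod (csum a n) <= rsum (fun k => Cmod (a k)) n.
Proof.
  induction n as [|n IH]; simpl; [rewrite Cmod_0; lra |].
  eapply Rle_trans; [apply Cmod_triangle | lra].
Qed.

Lemma csum_telescope (r : nat -> C) (n : nat) :
  csum (fun k => r k - r (S k))%C n = (r O - r n)%C.
Proof. induction n as [|n IH]; simpl; [| rewrite IH]; ring. Qed.

Lemma csum_ext (a b : nat -> C) (n : nat) :
  (forall k, a k = b k) -> csum a n = csum b n.
Proof. intros H; induction n as [|n IH]; simpl; congruence. Qed.

Lemma csum_Cmult (c : C) (a : nat -> C) (n : nat) :
  csum (fun k => c * a k)%C n = (c * csum a n)%C.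
Proof. induction n as [|n IH]; simpl; [| rewrite IH]; ring. Qed.

Lemma csum_lim_bounded (a : nat -> C) (l : C) : csum_lim a l ->
  exists M, 0 <= M /\ forall n, Cmod (csum a n - l) <= M.
Proof.
  intros H; destruct (H 1 Rlt_0_1) as [N HN].
  assert (HB : exists M, 0 <= M /\ forall n, (n < N)%nat -> Cmod (csum a n - l) <= M).
  { clear HN; induction N as [|N (M & HM0 & HM)]; [exists 0; split; [lra | intros; lia] |].
    exists (Rmax M (Cmod (csum a N - l))); split; [eapply Rle_trans; [| apply Rmax_l]; easy |].
    intros n Hn; destruct (Nat.eq_dec n N) as [-> | Hne]; [apply Rmax_r |].
    eapply Rle_trans; [apply HM; lia | apply Rmax_l]. }
  destruct HB as (M & HM0 & HM); exists (M + 1); split; [lra |]; intros n.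
  destruct (Nat.lt_ge_cases n N) as [Hn | Hn]; [specialize (HM n Hn) | specialize (HN n Hn)]; lra.
Qed.

(** The partial sums are centred at [l], so that when [l] is the sum of the series the factors
    multiplying the differences of [r] are small for late indices. *)
Lemma summation_by_parts (s r : nat -> C) (l : C) (n : nat) :
  csum (fun k => s k * r k)%C n = (l * r O + (csum s n - l) * r n
    + csum (fun k => (csum s (S k) - l) * (r k - r (S k))) n)%C.
Proof. induction n as [|n IH]; simpl; [| rewrite IH; simpl]; ring. Qed.

Lemma rsum_split_bound (T d : nat -> R) (M e : R) (N j : nat) :
  (forall k, 0 <= d k) -> (forall k, T k <= M) -> (forall k, (N <= k)%nat -> T k <= e) ->
  rsum (fun k => T k * d k) (N + j)
  <= M * rsum d N + e * (rsum d (N + j) - rsum d N).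
Proof.
  intros Hd HM He; induction j as [|j IH].
  - rewrite Nat.add_0_r.
    assert (H : rsum (fun k => T k * d k) N <= rsum (fun k => M * d k) N)
      by (apply rsum_le; intros k; apply Rmult_le_compat_r; auto).
    rewrite rsum_scal in H; lra.
  - rewrite Nat.add_succ_r; simpl.
    assert (T (N + j)%nat * d (N + j)%nat <= e * d (N + j)%nat)
      by (apply Rmult_le_compat_r; [auto | apply He; lia]).
    lra.
Qed.

Lemma rsum_nonneg (d : nat -> R) (n : nat) : (forall k, 0 <= d k) -> 0 <= rsum d n.
Proof. intros H; induction n as [|n IH]; simpl; [lra | specialize (H n); lra]. Qed.

(** After summation by parts, late indices are controlled by the small remainders of the series
    times the bounded variation. For the finitely many early ones the remainders are merely bounded,
    but the differences of [r] tend to 0 because all r_k have the same limit [B]. *)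
Lemma lim01_abel (s : nat -> C) (S0 : C) (r : nat -> R * R -> C) (L : R * R -> C)
    (B : C) (K M : R) :
  csum_lim s S0 ->
  (forall v u, 0 < v < 1 -> 0 < u < 1 -> csum_lim (fun n => s n * r n (v, u))%C (L (v, u))) ->
  (forall v u N, 0 < v < 1 -> 0 < u < 1 ->
    rsum (fun n => Cmod (r n (v, u) - r (S n) (v, u))) N <= M) ->
  (forall v u, 0 < v < 1 -> 0 < u < 1 -> Cmod (r O (v, u)) <= K) ->
  (forall n, lim01 (r n) B) ->
  lim01 L (B * S0)%C.
Proof.
  intros Hs HL HM HK Hr eps Heps.
  assert (HM0 : 0 <= M) by (apply (HM (1 / 2) (1 / 2) O); lra).
  assert (HK0 : 0 <= K).
  { eapply Rle_trans; [apply Cmod_ge_0 | apply (HK (1 / 2) (1 / 2)); lra]. }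
  destruct (csum_lim_bounded _ _ Hs) as (T & HT0 & HT).
  (* A quarter of [eps] each: [e1] pays for the last term, of size at most e1 (K + M), and the late
     differences, at most e1 M; [e2] for the early differences; [e3] for r_0 - B; the last quarter
     for truncating [L]. *)
  set (e1 := eps / (4 * (K + 2 * M + 1))).
  assert (He1 : 0 < e1) by (apply Rdiv_lt_0_compat; lra).
  set (e2 := eps / (4 * (T + 1))).
  assert (He2 : 0 < e2) by (apply Rdiv_lt_0_compat; lra).
  pose proof (Cmod_ge_0 S0) as HS0.
  set (e3 := eps / (4 * (Cmod S0 + 1))).
  assert (He3 : 0 < e3) by (apply Rdiv_lt_0_compat; lra).
  assert (E1 : e1 * (K + 2 * M) <= eps / 4).
  { replace (eps / 4) with (e1 * (K + 2 * M + 1)) by (unfold e1; field; lra); nra. }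
  assert (E2 : T * e2 <= eps / 4).
  { replace (eps / 4) with ((T + 1) * e2) by (unfold e2; field; lra); nra. }
  assert (E3 : Cmod S0 * e3 <= eps / 4).
  { replace (eps / 4) with ((Cmod S0 + 1) * e3) by (unfold e3; field; lra); nra. }
  destruct (Hs e1 He1) as [N0 HN0].
  assert (HD : forall n e, 0 < e ->
    at01 (fun y => rsum (fun k => Cmod (r k y - r (S k) y)) n < e)).
  { induction n as [|n IH]; intros e He; simpl; [apply filter_forall; easy |].
    assert (He2' : 0 < e / 2) by lra.
    assert (He4' : 0 < e / 4) by lra.
    generalize (filter_and _ _ (IH _ He2') (filter_and _ _ (Hr n _ He4') (Hr (S n) _ He4'))).
    apply filter_imp; intros y (H1 & H2 & H3).
    assert (Cmod (r n y - r (S n) y) <= Cmod (r n y - B) + Cmod (r (S n) y - B)).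
    { replace (r n y - r (S n) y)%C with ((r n y - B) + - (r (S n) y - B))%C by ring.
      eapply Rle_trans; [apply Cmod_triangle |]; rewrite Cmod_opp; lra. }
    lra. }
  generalize (filter_and _ _ at01_domain (filter_and _ _ (HD N0 e2 He2) (Hr O e3 He3))).
  apply filter_imp; intros [v u] ((Hv & Hu) & Hd & Hr0); simpl in Hv, Hu.
  assert (Hv' : 0 < v < 1) by lra; assert (Hu' : 0 < u < 1) by lra.
  specialize (HL v u Hv' Hu'); specialize (HK v u Hv' Hu').
  set (y := (v, u)) in *.
  assert (He4 : 0 < eps / 4) by lra.
  destruct (HL _ He4) as [N1 HN1].
  (* [N1] depends on (v, u), which is harmless: the variation bound [M] holds for any number of
     terms. *)
  set (N := (N0 + N1)%nat).
  specialize (HN1 N ltac:(unfold N; lia)).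
  assert (HrN : Cmod (r N y) <= K + M).
  { replace (r N y) with (r O y + - csum (fun k => r k y - r (S k) y)%C N)%C
      by (rewrite (csum_telescope (fun k => r k y)); ring).
    eapply Rle_trans; [apply Cmod_triangle |]; rewrite Cmod_opp.
    apply Rplus_le_compat; [easy |].
    eapply Rle_trans; [apply Cmod_csum | apply HM; easy]. }
  assert (HTN : Cmod (csum s N - S0) <= e1).
  { left; apply HN0; unfold N; lia. }
  assert (HR : Cmod (csum (fun k => (csum s (S k) - S0) * (r k y - r (S k) y))%C N)
    <= eps / 4 + e1 * M).
  { eapply Rle_trans; [apply Cmod_csum |].
    apply Rle_trans with (rsum (fun k => Cmod (csum s (S k) - S0) * Cmod (r k y - r (S k) y)) N);
      [apply rsum_le; intros k; rewrite Cmod_mult; lra |].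
    eapply Rle_trans.
    - apply (rsum_split_bound (fun k => Cmod (csum s (S k) - S0)) _ T e1 N0 N1).
      + intros; apply Cmod_ge_0.
      + intros; apply HT.
      + intros k Hk; left; apply HN0; lia.
    - fold N.
      assert (0 <= rsum (fun k => Cmod (r k y - r (S k) y)) N0)
        by (apply rsum_nonneg; intros; apply Cmod_ge_0).
      specialize (HM v u N Hv' Hu'); fold y in HM.
      apply Rplus_le_compat; [nra |].
      apply Rmult_le_compat_l; lra. }
  replace (L y - B * S0)%C with (- (csum (fun k => s k * r k y)%C N - L y)
    + (S0 * (r O y - B) + ((csum s N - S0) * r N y
    + csum (fun k => (csum s (S k) - S0) * (r k y - r (S k) y)) N)))%C
    by (rewrite (summation_by_parts s (fun k => r k y) S0 N); ring).
  eapply Rle_lt_trans; [apply Cmod_triangle |]; rewrite Cmod_opp.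
  apply Rlt_le_trans with (eps / 4 + (eps / 4 + (e1 * (K + M) + (eps / 4 + e1 * M)))); [| lra].
  apply Rplus_lt_le_compat; [easy |].
  eapply Rle_trans; [apply Cmod_triangle |]; apply Rplus_le_compat.
  { rewrite Cmod_mult; eapply Rle_trans; [| apply E3].
    apply Rmult_le_compat_l; lra. }
  eapply Rle_trans; [apply Cmod_triangle |]; apply Rplus_le_compat; [| easy].
  rewrite Cmod_mult; apply Rmult_le_compat; try apply Cmod_ge_0; easy.
Qed.

(** * Total variation *)

Fixpoint rpoch (x : R) (n : nat) : R :=
  match n with
  | O => 1
  | S m => rpoch x m * (x + INR m)
  end.

Lemma rpoch_pos (x : R) (n : nat) : 0 < x -> 0 < rpoch x n.
Proof.
  intros Hx; induction n as [|n IH]; simpl; [lra |].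
  pose proof (pos_INR n); apply Rmult_lt_0_compat; lra.
Qed.

Lemma poch_neq0 (a : C) (n : nat) : 0 < Re a -> poch a n <> 0.
Proof.
  intros Ha; induction n as [|n IH]; simpl.
  - intros H; apply RtoC_inj in H; lra.
  - apply Cmult_neq_0; [easy |]; apply Re_pos_neq0.
    pose proof (pos_INR n); unfold Re in *; simpl in *; lra.
Qed.

(** Factor by factor, a modulus is at least the real part. With the upper bound of [Cmod_poch_le] it
    compares |(gamma)_n / (beta)_n| with the real quotient. *)
Lemma Cmod_poch_ge (a : C) (n : nat) : 0 < Re a -> rpoch (Re a) n <= Cmod (poch a n).
Proof.
  intros Ha; induction n as [|n IH]; simpl; [rewrite Cmod_1; lra |].
  rewrite Cmod_mult; pose proof (pos_INR n).
  apply Rmult_le_compat; [left; apply rpoch_pos; easy | lra | easy |].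
  eapply Rle_trans; [| apply (Rle_trans _ _ _ (Rmax_l _ _) (Rmax_Cmod _))].
  eapply Rle_trans; [| apply Rle_abs]; unfold Re; simpl; lra.
Qed.

(* |g + n| <= x (1 + y^2 / x^2) with x = Re g + n, y = Im g, and the sum of the
   1 / x^2 is dominated by a telescoping sum. *)
Lemma Cmod_poch_le (g : C) : 0 < Re g ->
  exists W, 0 < W /\ forall n, Cmod (poch g n) <= W * rpoch (Re g) n.
Proof.
  intros Hg.
  (* For X >= G one has (X + 1) / X <= (G + 1) / G, hence (Im g)^2 / X^2 <= E (1/X - 1/(X + 1)),
     which telescopes to at most E / G. *)
  set (G := Re g) in *; set (E := Im g * Im g * ((G + 1) / G)).
  assert (HE : 0 <= E).
  { apply Rmult_le_pos; [apply Rle_0_sqr |]; left; apply Rdiv_lt_0_compat; lra. }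
  exists (exp (E / G)); split; [apply exp_pos |].
  assert (H : forall n, Cmod (poch g n) <= exp (E * (/ G - / (G + INR n))) * rpoch G n).
  { induction n as [|n IH].
    - simpl INR; rewrite Rplus_0_r, Rminus_diag, Rmult_0_r, exp_0; simpl; rewrite Cmod_1; lra.
    - simpl poch; simpl rpoch; rewrite Cmod_mult.
      pose proof (pos_INR n) as Hn.
      set (X := G + INR n) in *; assert (HX : 0 < X) by (unfold X; lra).
      assert (HXG : G <= X) by (unfold X; lra).
      replace (G + INR (S n)) with (X + 1) by (rewrite S_INR; unfold X; ring).
      replace (E * (/ G - / (X + 1)))
        with (E * (/ G - / X) + E * (/ X - / (X + 1))) by ring.
      rewrite exp_plus.
      replace (_ * _ * (rpoch G n * X)) with
        (exp (E * (/ G - / X)) * rpoch G n * (exp (E * (/ X - / (X + 1))) * X)) by ring.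
      apply Rmult_le_compat; try apply Cmod_ge_0; [easy |].
      assert (HEX : Im g * Im g / (X * X) <= E * (/ X - / (X + 1))).
      { replace (E * (/ X - / (X + 1)))
          with (Im g * Im g * ((G + 1) / G * / (X * (X + 1)))) by (unfold E; field; lra).
        apply Rmult_le_compat_l; [apply Rle_0_sqr |].
        apply Rmult_le_reg_r with (X * X * (X + 1) * G); [repeat apply Rmult_lt_0_compat; lra |].
        replace (/ (X * X) * (X * X * (X + 1) * G)) with ((X + 1) * G) by (field; lra).
        replace ((G + 1) / G * / (X * (X + 1)) * (X * X * (X + 1) * G)) with ((G + 1) * X)
          by (field; lra).
        nra. }
      pose proof (exp_ineq1_le (E * (/ X - / (X + 1)))) as Hexp.
      apply Rle_trans with ((1 + Im g * Im g / (X * X)) * X); [| apply Rmult_le_compat_r; lra].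
      assert (Hq : 0 <= Im g * Im g / X).
      { apply Rmult_le_pos; [apply Rle_0_sqr |]; left; apply Rinv_0_lt_compat; easy. }
      replace ((1 + Im g * Im g / (X * X)) * X) with (X + Im g * Im g / X) by (field; lra).
      rewrite <- (sqrt_Rsqr (X + Im g * Im g / X)) by lra.
      unfold Cmod; apply sqrt_le_1_alt.
      replace (fst (g + INR n)%C) with X by reflexivity.
      replace (snd (g + INR n)%C) with (Im g) by (unfold Im; simpl; ring).
      replace (Rsqr (X + Im g * Im g / X))
        with (X ^ 2 + 2 * (Im g * Im g) + (Im g * Im g / X) * (Im g * Im g / X))
        by (unfold Rsqr; field; lra).
      assert (0 <= Im g * Im g) by apply Rle_0_sqr; nra. }
  intros n; eapply Rle_trans; [apply H |].
  apply Rmult_le_compat_r; [left; apply rpoch_pos; easy |].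
  pose proof (pos_INR n).
  assert (0 < / (G + INR n)) by (apply Rinv_0_lt_compat; lra).
  assert (HEl : E * (/ G - / (G + INR n)) <= E / G).
  { unfold Rdiv; rewrite Rmult_minus_distr_l; nra. }
  destruct HEl as [HEl | ->]; [left; apply exp_increasing; easy | lra].
Qed.

Lemma Cmod_beta_ker_edge (a b : C) (n : nat) (t : R) :
  Cmod (beta_ker (a + INR n + 1) (b + 1) t)
  = Re (beta_ker (RtoC (Re a) + INR n + 1) (RtoC (Re b) + 1) t).
Proof.
  rewrite <- (re_RtoC (Cmod _)), Cmod_beta_ker; f_equal; f_equal.
  - unfold Re, RtoC, Cplus; simpl; f_equal; ring.
  - unfold Re, RtoC, Cplus; simpl; f_equal; ring.
Qed.

(** The weights are those for which the weighted boundary terms are the differences r_n - r_(n+1)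
    with real parameters. Their sum is r_0 - r_N, and r_N >= 0 leaves the bound of r_0. Treating one
    endpoint at a time keeps all summands nonnegative. *)
Lemma rsum_edge_bound (a b : R) : 0 < a -> 0 < b ->
  exists K, forall u N, 0 < u < 1 ->
  rsum (fun n => rpoch (a + b) n / rpoch a n / (a + INR n)
    * Re (beta_ker (RtoC a + INR n + 1) (RtoC b + 1) u)) N <= K.
Proof.
  intros Ha Hb.
  destruct (beta_int_bounded a b Ha Hb) as [K HK].
  exists K; intros u N Hu.
  set (w := fun n => rpoch (a + b) n / rpoch a n / (a + INR n)).
  set (e := fun n t => Re (beta_ker (RtoC a + INR n + 1) (RtoC b + 1) t)).
  change (rsum (fun n => w n * e n u) N <= K).
  assert (Hw : forall n, 0 < w n).
  { intros n; pose proof (pos_INR n); unfold w.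
    repeat apply Rdiv_lt_0_compat; try apply rpoch_pos; lra. }
  (* Replaces setting v = 0, where the logarithm in the kernel has no meaning. The threshold depends
     on [N], but the final bound [K] does not. *)
  assert (Hsmall : forall eps, 0 < eps ->
    exists d, 0 < d /\ forall v, 0 < v < d -> v < 1 -> rsum (fun n => w n * e n v) N < eps).
  { clear u Hu; induction N as [|N IH]; intros eps Heps; [exists 1; simpl; split; intros; lra |].
    destruct (IH (eps / 2)) as (d1 & Hd1 & H1); [lra |].
    assert (He : 0 < eps / 2 / w N) by (apply Rdiv_lt_0_compat; [lra | apply Hw]).
    pose proof (pos_INR N) as HN.
    destruct (exp_mult_ln_lt (a + INR N) (eps / 2 / w N)) as (d2 & Hd2 & H2); [lra | easy |].
    exists (Rmin d1 d2); split; [apply Rmin_pos; easy |]; intros v Hv Hv1.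
    pose proof (Rmin_l d1 d2); pose proof (Rmin_r d1 d2).
    specialize (H1 v ltac:(lra) Hv1); specialize (H2 v ltac:(lra)).
    simpl; assert (e N v <= exp ((a + INR N) * ln v)).
    { unfold e; pose proof (Cmod_beta_ker_edge (RtoC a) (RtoC b) N v) as E.
      rewrite !re_RtoC in E; rewrite <- E.
      destruct (Cmod_beta_ker_le1 (RtoC a + INR N) (RtoC b) v) as [E1 _];
        [unfold Re; simpl; lra | unfold Re; simpl; lra | lra |].
      eapply Rle_trans; [apply E1 |]; unfold Re; simpl; lra. }
    assert (w N * e N v < eps / 2).
    { specialize (Hw N); replace (eps / 2) with (w N * (eps / 2 / w N)) by (field; lra).
      apply Rmult_lt_compat_l; lra. }
    lra. }
  assert (Htel : forall v, 0 < v < 1 -> forall n,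
    rsum (fun n => w n * e n u) n - rsum (fun n => w n * e n v) n
    = Re (beta_int a b (v, u))
      - rpoch (a + b) n / rpoch a n * Re (beta_int (RtoC a + INR n) b (v, u))).
  { intros v Hv; induction n as [|n IH].
    - simpl rsum; simpl rpoch; simpl INR; rewrite Cplus_0_r; field.
    - pose proof (pos_INR n) as Hn; pose proof (rpoch_pos a n Ha) as Hp.
      pose proof (beta_int_Sl (RtoC a + INR n) b v u Hv Hu) as E.
      apply (f_equal Re) in E.
      rewrite S_INR; simpl rsum; simpl rpoch.
      rewrite (RtoC_plus (INR n)), Cplus_assoc.
      assert (E' : (a + INR n) * Re (beta_int (RtoC a + INR n) b (v, u))
        - (a + INR n + b) * Re (beta_int (RtoC a + INR n + 1) b (v, u)) = e n u - e n v).
      { unfold e; revert E; unfold Re; simpl; intros E; lra. }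
      unfold w at 2 4.
      replace (_ - _) with ((rsum (fun n => w n * e n u) n - rsum (fun n => w n * e n v) n)
        + rpoch (a + b) n / rpoch a n / (a + INR n) * (e n u - e n v)) by ring.
      rewrite IH, <- E'; field; lra. }
  apply le_epsilon; intros eps Heps.
  destruct (Hsmall eps Heps) as (d & Hd & H).
  (* Below [d] for the smallness, and below [u] so that the integral over [v, u] is nonnegative. *)
  set (v := Rmin (d / 2) (u / 2)).
  assert (Hv : 0 < v) by (apply Rmin_pos; lra).
  pose proof (Rmin_l (d / 2) (u / 2)) as Hv1; pose proof (Rmin_r (d / 2) (u / 2)) as Hv2.
  fold v in Hv1, Hv2.
  specialize (H v ltac:(lra) ltac:(lra)); specialize (Htel v ltac:(lra) N).
  specialize (HK v u ltac:(lra) Hu).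
  assert (Hpos : 0 <= Re (beta_int (RtoC a + INR N) b (v, u))).
  { apply (is_RInt_Re_ge0 (beta_ker (RtoC a + INR N) b) v u); [lra | apply is_RInt_beta_ker; lra |].
    intros t Ht; rewrite <- RtoC_plus; left; apply Re_beta_ker_pos. }
  assert (0 <= rpoch (a + b) N / rpoch a N * Re (beta_int (RtoC a + INR N) b (v, u))).
  { apply Rmult_le_pos; [left; apply Rdiv_lt_0_compat; apply rpoch_pos; lra | easy]. }
  pose proof (Rle_trans _ _ _ (Rmax_l _ _) (Rmax_Cmod (beta_int a b (v, u)))) as Hm.
  pose proof (Rle_abs (fst (beta_int a b (v, u)))) as Hm'.
  unfold Re in *; lra.
Qed.

(** The r_n of the overview, with beta = a and gamma = a + b. The prefactor makes the limit B(a, b)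
    the same for every [n]. *)
Definition beta_ratio (a b : C) (n : nat) (y : R * R) : C :=
  (poch (a + b) n / poch a n * beta_int (a + INR n) b y)%C.

Lemma Re_plus_INR (a : C) (n : nat) : 0 < Re a -> 0 < Re (a + INR n).
Proof. pose proof (pos_INR n); unfold Re; simpl; lra. Qed.

Lemma Re_plus_pos (a b : C) : 0 < Re a -> 0 < Re b -> 0 < Re (a + b).
Proof. unfold Re; simpl; lra. Qed.

Lemma CBeta_plus_INR (a b : C) (n : nat) : 0 < Re a -> 0 < Re b ->
  (poch (a + b) n / poch a n * CBeta (a + INR n) b)%C = CBeta a b.
Proof.
  intros Ha Hb; induction n as [|n IH].
  - simpl; rewrite Cplus_0_r; field.
  - rewrite <- IH; rewrite S_INR, RtoC_plus, Cplus_assoc; simpl poch.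
    pose proof (CBeta_Sl _ b (Re_plus_INR a n Ha) Hb) as E.
    pose proof (Re_pos_neq0 _ (Re_plus_INR a n Ha)) as N1.
    pose proof (poch_neq0 a n Ha) as N2.
    replace (CBeta (a + INR n) b) with (/ (a + INR n) * ((a + INR n) * CBeta (a + INR n) b))%C
      by (field; easy).
    rewrite E; field; easy.
Qed.

Lemma lim01_beta_ratio (a b : C) (n : nat) : 0 < Re a -> 0 < Re b ->
  lim01 (beta_ratio a b n) (CBeta a b).
Proof.
  intros Ha Hb; rewrite <- (CBeta_plus_INR a b n) by easy.
  apply lim01_Cmult, lim01_CBeta; [apply Re_plus_INR |]; easy.
Qed.

Lemma beta_ratio_diff (a b : C) (n : nat) (v u : R) : 0 < Re a ->
  0 < v < 1 -> 0 < u < 1 ->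
  (beta_ratio a b n (v, u) - beta_ratio a b (S n) (v, u))%C
  = (poch (a + b) n / poch a n / (a + INR n)
     * (beta_ker (a + INR n + 1) (b + 1) u - beta_ker (a + INR n + 1) (b + 1) v))%C.
Proof.
  intros Ha Hv Hu; unfold beta_ratio.
  pose proof (Re_pos_neq0 _ (Re_plus_INR a n Ha)) as N1.
  pose proof (poch_neq0 a n Ha) as N2.
  rewrite <- beta_int_Sl by easy.
  rewrite S_INR, RtoC_plus, Cplus_assoc; simpl poch; field; easy.
Qed.

Lemma beta_ratio_variation (a b : C) : 0 < Re a -> 0 < Re b ->
  exists M, forall v u N, 0 < v < 1 -> 0 < u < 1 ->
  rsum (fun n => Cmod (beta_ratio a b n (v, u) - beta_ratio a b (S n) (v, u))) N <= M.
Proof.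
  intros Ha Hb.
  destruct (Cmod_poch_le (a + b) (Re_plus_pos a b Ha Hb)) as (W & HW & HWn).
  destruct (rsum_edge_bound (Re a) (Re b) Ha Hb) as [K HK].
  (* [W] comes from the modulus of (a + b)_n; each of the endpoints [u] and [v] contributes one
     [K]. *)
  exists (W * (K + K)); intros v u N Hv Hu.
  set (w := fun n => rpoch (Re a + Re b) n / rpoch (Re a) n / (Re a + INR n)).
  set (e := fun n t => Re (beta_ker (RtoC (Re a) + INR n + 1) (RtoC (Re b) + 1) t)).
  apply Rle_trans with (rsum (fun n => W * (w n * e n u + w n * e n v)) N).
  - apply rsum_le; intros n; rewrite beta_ratio_diff by easy.
    pose proof (pos_INR n) as Hn.
    pose proof (Re_pos_neq0 _ (Re_plus_INR a n Ha)) as N1.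
    pose proof (poch_neq0 a n Ha) as N2.
    pose proof (rpoch_pos (Re a) n Ha) as P1.
    assert (P2 : 0 < rpoch (Re a + Re b) n) by (apply rpoch_pos; lra).
    assert (L : Re a + INR n <= Cmod (a + INR n)).
    { eapply Rle_trans; [| apply (Rle_trans _ _ _ (Rmax_l _ _) (Rmax_Cmod _))].
      eapply Rle_trans; [| apply Rle_abs]; unfold Re; simpl; lra. }
    rewrite Cmod_mult, !Cmod_div by easy.
    rewrite <- Rmult_plus_distr_l, <- Rmult_assoc.
    apply Rmult_le_compat; [| apply Cmod_ge_0 | |].
    + apply Rle_mult_inv_pos; [apply Rle_mult_inv_pos |]; try apply Cmod_ge_0;
        apply Cmod_gt_0; easy.
    + unfold w, Rdiv; rewrite <- !Rmult_assoc.
      apply Rmult_le_compat; [| left; apply Rinv_0_lt_compat, Cmod_gt_0; easy | |].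
      * apply Rle_mult_inv_pos; [apply Cmod_ge_0 | apply Cmod_gt_0; easy].
      * apply Rmult_le_compat; [apply Cmod_ge_0 | left; apply Rinv_0_lt_compat, Cmod_gt_0; easy
          | apply HWn |].
        apply Rinv_le_contravar; [easy | apply Cmod_poch_ge; easy].
      * apply Rinv_le_contravar; [lra | easy].
    + eapply Rle_trans; [apply Cmod_triangle |].
      rewrite Cmod_opp, !Cmod_beta_ker_edge; apply Rle_refl.
  - rewrite rsum_scal, rsum_plus; apply Rmult_le_compat_l; [lra |].
    apply Rplus_le_compat; apply HK; easy.
Qed.

(** * Termwise integration *)

Lemma csum_Sn (a : nat -> C) (n : nat) : csum a (S n) = sum_n (G := CRN) a n.
Proof.
  induction n as [|n IH].
  - rewrite sum_O; simpl; ring.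
  - rewrite sum_Sn, <- IH; easy.
Qed.

Lemma is_series_csum_lim (a : nat -> C) (l : C) : is_series (V := CRN) a l -> csum_lim a l.
Proof.
  intros H eps Heps.
  pose proof (proj1 (filterlim_locally_ball_norm (K := R_AbsRing) (U := CRN) _ _) H
    (mkposreal eps Heps)) as [N HN].
  exists (S N); intros [|n] Hn; [lia |].
  rewrite csum_Sn, <- norm_Cmod; apply HN; lia.
Qed.

Lemma csum_lim_is_series_Re (a : nat -> C) (l : C) : csum_lim a l ->
  is_series (fun n => Re (a n)) (Re l).
Proof.
  intros H.
  apply (filterlim_locally_ball_norm (K := R_AbsRing) (U := R_NormedModule)); intros eps.
  destruct (H eps (cond_pos eps)) as [N HN].
  exists N; intros n Hn; specialize (HN (S n) ltac:(lia)).
  assert (E : forall k, sum_n (fun k => Re (a k)) k = Re (csum a (S k))).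
  { clear; induction k as [|k IH]; [rewrite sum_O; unfold Re; simpl; ring |].
    rewrite sum_Sn, IH; easy. }
  change (Rabs (sum_n (fun k => Re (a k)) n - Re l) < eps); rewrite E.
  eapply Rle_lt_trans; [| apply HN].
  apply (Rle_trans _ _ _ (Rmax_l _ _) (Rmax_Cmod (csum a (S n) - l)%C)).
Qed.

Lemma csum_lim_is_series_Im (a : nat -> C) (l : C) : csum_lim a l ->
  is_series (fun n => Im (a n)) (Im l).
Proof.
  intros H.
  apply (filterlim_locally_ball_norm (K := R_AbsRing) (U := R_NormedModule)); intros eps.
  destruct (H eps (cond_pos eps)) as [N HN].
  exists N; intros n Hn; specialize (HN (S n) ltac:(lia)).
  assert (E : forall k, sum_n (fun k => Im (a k)) k = Im (csum a (S k))).
  { clear; induction k as [|k IH]; [rewrite sum_O; unfold Im; simpl; ring |].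
    rewrite sum_Sn, IH; easy. }
  change (Rabs (sum_n (fun k => Im (a k)) n - Im l) < eps); rewrite E.
  eapply Rle_lt_trans; [| apply HN].
  apply (Rle_trans _ _ _ (Rmax_r _ _) (Rmax_Cmod (csum a (S n) - l)%C)).
Qed.

(** [ex_CSeries] means convergence in C, whereas [CSeries] sums real and imaginary parts separately;
    this reconciles them. *)
Lemma csum_lim_CSeries (a : nat -> C) : ex_CSeries a -> csum_lim a (CSeries a).
Proof.
  intros [l Hl]; apply is_series_csum_lim in Hl.
  replace (CSeries a) with l; [easy |].
  unfold CSeries.
  rewrite (is_series_unique _ _ (csum_lim_is_series_Re a l Hl)),
    (is_series_unique _ _ (csum_lim_is_series_Im a l Hl)).
  destruct l; easy.
Qed.

Lemma csum_lim_terms_bounded (a : nat -> C) (l : C) : csum_lim a l ->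
  exists M, 0 <= M /\ forall n, Cmod (a n) <= M.
Proof.
  intros H; destruct (csum_lim_bounded a l H) as (M & HM0 & HM).
  exists (M + M); split; [lra |]; intros n.
  replace (a n) with ((csum a (S n) - l) + - (csum a n - l))%C by (simpl; ring).
  eapply Rle_trans; [apply Cmod_triangle |]; rewrite Cmod_opp.
  apply Rplus_le_compat; apply HM.
Qed.

Lemma csum_lim_geometric_tail (a : nat -> C) (l : C) (D q : R) (N : nat) :
  csum_lim a l -> 0 <= q < 1 -> (forall n, Cmod (a n) <= D * q ^ n) ->
  Cmod (csum a N - l) <= D * q ^ N / (1 - q).
Proof.
  intros Hl Hq Ha.
  assert (HD : 0 <= D).
  { pose proof (Rle_trans _ _ _ (Cmod_ge_0 _) (Ha O)) as H; simpl in H; lra. }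
  assert (Hj : forall j, Cmod (csum a (N + j) - csum a N) <= D * q ^ N * ((1 - q ^ j) / (1 - q))).
  { induction j as [|j IH].
    - rewrite Nat.add_0_r; replace (csum a N - csum a N)%C with (RtoC 0) by ring.
      rewrite Cmod_0; simpl; right; field; lra.
    - rewrite Nat.add_succ_r; simpl csum.
      replace (_ - _)%C with ((csum a (N + j) - csum a N) + a (N + j)%nat)%C by ring.
      eapply Rle_trans; [apply Cmod_triangle |].
      specialize (Ha (N + j)%nat); rewrite pow_add in Ha.
      replace (D * q ^ N * ((1 - q ^ S j) / (1 - q)))
        with (D * q ^ N * ((1 - q ^ j) / (1 - q)) + D * (q ^ N * q ^ j)) by (simpl; field; lra).
      lra. }
  apply le_epsilon; intros eps Heps.
  destruct (Hl eps Heps) as [M HM].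
  specialize (HM (N + M)%nat ltac:(lia)); specialize (Hj M).
  replace (csum a N - l)%C with (- (csum a (N + M) - csum a N) + (csum a (N + M) - l))%C by ring.
  eapply Rle_trans; [apply Cmod_triangle |]; rewrite Cmod_opp.
  apply Rplus_le_compat; [| lra].
  eapply Rle_trans; [apply Hj |].
  unfold Rdiv at 2; apply Rmult_le_compat_l.
  - apply Rmult_le_pos; [easy | apply pow_le; lra].
  - apply Rle_trans with (1 / (1 - q)); [| lra].
    apply Rmult_le_compat_r; [left; apply Rinv_0_lt_compat; lra |].
    pose proof (pow_le q M (proj1 Hq)); lra.
Qed.

Lemma is_RInt_csum (f : nat -> R -> C) (v u : R) (l : nat -> C) (N : nat) :
  (forall n, is_RInt (V := CRN) (f n) v u (l n)) ->
  is_RInt (V := CRN) (fun t => csum (fun n => f n t) N) v u (csum l N).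
Proof.
  intros H; induction N as [|N IH]; simpl.
  - pose proof (is_RInt_const (V := CRN) v u (RtoC 0)) as E.
    rewrite scal_R_Cmult, Cmult_0_r in E; easy.
  - apply (is_RInt_plus (V := CRN)); easy.
Qed.

Lemma beta_ker_bounded (a b : C) (m M : R) : 0 < Re a -> 0 < Re b -> 0 < m -> M < 1 ->
  exists K, 0 < K /\ forall t, m <= t <= M -> Cmod (beta_ker a b t) <= K.
Proof.
  (* t (1-t) times the kernel is the kernel at (a + 1, b + 1), at most 1 in modulus, and t (1-t) >=
     m (1 - M). *)
  intros Ha Hb Hm HM; exists (/ (m * (1 - M))).
  assert (Hmm : 0 < m * (1 - M)) by (apply Rmult_lt_0_compat; lra).
  split; [apply Rinv_0_lt_compat; easy |]; intros t Ht.
  destruct (Cmod_beta_ker_le1 a b t) as (_ & _ & E); try lra.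
  rewrite beta_ker_Sr, beta_ker_Sl, !Cmod_mult, !Cmod_R, !Rabs_pos_eq in E by lra.
  apply Rmult_le_reg_l with (m * (1 - M)); [easy |].
  rewrite Rinv_r by lra.
  eapply Rle_trans; [| apply E].
  replace ((1 - t) * (t * Cmod (beta_ker a b t)))
    with (t * (1 - t) * Cmod (beta_ker a b t)) by ring.
  apply Rmult_le_compat_r; [apply Cmod_ge_0 |].
  apply Rmult_le_compat; lra.
Qed.

(** Convergence at a point T between M and 1 bounds |b_n| T^n, so on (0, M] the terms are dominated
    by a geometric series of ratio M / T. *)
Lemma power_series_uniform (b : nat -> C) (M eps : R) :
  (forall t, 0 < t < 1 -> ex_CSeries (fun n => b n * RtoC (t ^ n))%C) ->
  M < 1 -> 0 < eps ->
  exists N, forall n t, (N <= n)%nat -> 0 < t <= M ->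
  Cmod (csum (fun k => b k * RtoC (t ^ k))%C n - CSeries (fun k => b k * RtoC (t ^ k))%C) < eps.
Proof.
  intros Hb HM Heps.
  destruct (Rle_lt_dec M 0) as [HM0 | HM0]; [exists O; intros; lra |].
  set (T := (1 + M) / 2).
  assert (HT : M < T < 1) by (unfold T; lra).
  destruct (csum_lim_terms_bounded _ _ (csum_lim_CSeries _ (Hb T ltac:(lra)))) as (D & HD & HDn).
  set (q := M / T).
  assert (Hq : 0 <= q < 1).
  { unfold q; split; [left; apply Rdiv_lt_0_compat; lra | apply Rlt_div_l; lra]. }
  assert (He : 0 < eps * (1 - q) / (D + 1)).
  { apply Rdiv_lt_0_compat; [apply Rmult_lt_0_compat |]; lra. }
  destruct (pow_lt_1_zero q) with (y := eps * (1 - q) / (D + 1)) as [N HN];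
    [rewrite Rabs_pos_eq; lra | easy |].
  exists N; intros n t Hn Ht.
  eapply Rle_lt_trans.
  - apply (csum_lim_geometric_tail _ _ D q n); [apply csum_lim_CSeries, Hb; lra | easy |].
    intros k; rewrite Cmod_mult, Cmod_R, Rabs_pos_eq by (apply pow_le; lra).
    specialize (HDn k); rewrite Cmod_mult, Cmod_R, Rabs_pos_eq in HDn by (apply pow_le; lra).
    apply Rle_trans with (Cmod (b k) * M ^ k).
    + apply Rmult_le_compat_l; [apply Cmod_ge_0 | apply pow_incr; lra].
    + replace (M ^ k) with (T ^ k * q ^ k)
        by (rewrite <- Rpow_mult_distr; f_equal; unfold q; field; lra).
      rewrite <- Rmult_assoc; apply Rmult_le_compat_r; [apply pow_le |]; lra.
  - specialize (HN n Hn); rewrite Rabs_pos_eq in HN by (apply pow_le; lra).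
    apply Rlt_div_l; [lra |].
    apply Rle_lt_trans with ((D + 1) * q ^ n).
    + apply Rmult_le_compat_r; [apply pow_le |]; lra.
    + apply Rmult_lt_compat_l with (r := D + 1) in HN; [| lra].
      replace ((D + 1) * (eps * (1 - q) / (D + 1))) with (eps * (1 - q)) in HN
        by (field; lra); easy.
Qed.

(** Between [v] and [u] the kernel is bounded and the power series converges uniformly, so sum and
    integral commute; the factor t^n raises the first parameter by [n]. *)
Lemma is_RInt_beta_power_series (a c : C) (b : nat -> C) (v u : R) :
  (forall t, 0 < t < 1 -> ex_CSeries (fun n => b n * RtoC (t ^ n))%C) ->
  0 < Re a -> 0 < Re c -> 0 < v < 1 -> 0 < u < 1 ->
  exists l : C,
  is_RInt (V := CRN)
    (fun t => beta_ker a c t * CSeries (fun n => b n * RtoC (t ^ n)))%C v u l /\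
  csum_lim (fun n => b n * beta_int (a + INR n) c (v, u))%C l.
Proof.
  intros Hb Ha Hc Hv Hu.
  set (m := Rmin v u); set (M := Rmax v u).
  assert (Hm : 0 < m) by (apply Rmin_pos; lra).
  assert (HM : M < 1) by (apply Rmax_lub_lt; lra).
  assert (HmM : m <= M) by (apply (Rle_trans _ v); [apply Rmin_l | apply Rmax_l]).
  (* [filterlim_RInt] asks for uniform convergence on all of R, hence the clamping. *)
  set (k := fun t => Rmax m (Rmin M t)).
  assert (Hk : forall t, m <= k t <= M).
  { intros t; split; [apply Rmax_l | apply Rmax_lub; [easy | apply Rmin_l]]. }
  assert (Hkid : forall t, m < t < M -> k t = t).
  { intros t Ht; unfold k; rewrite Rmin_right, Rmax_right; lra. }
  destruct (beta_ker_bounded a c m M Ha Hc Hm HM) as (K & HK0 & HK).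
  set (f := fun n t => (beta_ker a c (k t) * csum (fun j => b j * RtoC (k t ^ j)) n)%C).
  set (g := fun t => (beta_ker a c (k t) * CSeries (fun j => b j * RtoC (k t ^ j)))%C).
  set (h := csum (fun n => b n * beta_int (a + INR n) c (v, u))%C).
  destruct (filterlim_RInt (V := CRC) f v u eventually _ g h) as (l & Hl1 & Hl2).
  - intros n.
    apply (is_RInt_ext (V := CRN)
      (fun t => csum (fun j => b j * beta_ker (a + INR j) c t)%C n)).
    + fold m M; intros t Ht; unfold f; rewrite Hkid, <- csum_Cmult by easy.
      apply csum_ext; intros j; rewrite beta_ker_nat by lra; ring.
    + apply is_RInt_csum; intros j; apply is_RInt_Cmult, is_RInt_beta_ker; easy.
  - apply (filterlim_locally (U := fct_UniformSpace R CRC)); intros eps.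
    pose proof (cond_pos eps) as He.
    destruct (power_series_uniform b M (eps / K) Hb HM) as [N HN];
      [apply Rdiv_lt_0_compat; easy |].
    exists N; intros n Hn t; specialize (Hk t); specialize (HN n (k t) Hn).
    apply (norm_compat1 (V := CRN)); rewrite norm_Cmod.
    change (Cmod (f n t - g t)%C < eps); unfold f, g.
    replace (_ - _)%C with (beta_ker a c (k t) * (csum (fun j => b j * RtoC (k t ^ j)) n
      - CSeries (fun j => b j * RtoC (k t ^ j))))%C by ring.
    rewrite Cmod_mult.
    apply Rle_lt_trans with (K * Cmod (csum (fun j => b j * RtoC (k t ^ j))%C n
      - CSeries (fun j => b j * RtoC (k t ^ j))%C)).
    + apply Rmult_le_compat_r; [apply Cmod_ge_0 | apply HK; easy].
    + replace (pos eps) with (K * (eps / K)) by (field; lra).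
      apply Rmult_lt_compat_l; [easy | apply HN; lra].
  - exists l; split.
    + revert Hl2; apply (is_RInt_ext (V := CRN)).
      fold m M; intros t Ht; unfold g; rewrite Hkid; easy.
    + intros eps Heps.
      destruct (proj1 (filterlim_locally_ball_norm (K := R_AbsRing) (U := CRN) _ _) Hl1
        (mkposreal eps Heps)) as [N HN].
      exists N; intros n Hn; rewrite <- norm_Cmod; apply HN; easy.
Qed.

Lemma beta_integral_power_series (a c : C) (b : nat -> C) : 0 < Re a -> 0 < Re c ->
  (forall t, 0 < t < 1 -> ex_CSeries (fun n => b n * RtoC (t ^ n))%C) ->
  ex_CSeries (fun n => b n * (poch a n / poch (a + c) n))%C ->
  is_RInt_gen (V := CRN) (fun t => beta_ker a c t * CSeries (fun n => b n * RtoC (t ^ n)))%C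
    (at_right 0) (at_left 1)
    (CBeta a c * CSeries (fun n => b n * (poch a n / poch (a + c) n)))%C.
Proof.
  intros Ha Hc Hb Hs.
  set (f := fun t => (beta_ker a c t * CSeries (fun n => b n * RtoC (t ^ n)))%C).
  set (L := fun y : R * R => RInt (V := CRC) f (fst y) (snd y)).
  assert (HL : forall v u, 0 < v < 1 -> 0 < u < 1 ->
    is_RInt (V := CRN) f v u (L (v, u)) /\
    csum_lim (fun n => b n * beta_int (a + INR n) c (v, u))%C (L (v, u))).
  { intros v u Hv Hu.
    destruct (is_RInt_beta_power_series a c b v u Hb Ha Hc Hv Hu) as (l & H1 & H2).
    replace (L (v, u)) with l; [easy |].
    symmetry; apply (is_RInt_unique (V := CRC)); easy. }
  apply (lim01_is_RInt_gen f L); [apply HL |].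
  destruct (beta_int_bounded a c Ha Hc) as [K HK].
  destruct (beta_ratio_variation a c Ha Hc) as [M HM].
  (* The Pochhammer quotient in the series and the inverse one in [beta_ratio] cancel, so the
     products are the integrated terms b_n G_n. *)
  apply (lim01_abel (fun n => b n * (poch a n / poch (a + c) n))%C _ (beta_ratio a c) L _ K M).
  - apply csum_lim_CSeries; easy.
  - intros v u Hv Hu eps Heps.
    destruct (proj2 (HL v u Hv Hu) eps Heps) as [N HN].
    exists N; intros n Hn.
    erewrite csum_ext; [apply (HN n Hn) |].
    intros j; unfold beta_ratio; cbv beta.
    pose proof (poch_neq0 a j Ha) as N1.
    pose proof (poch_neq0 (a + c) j (Re_plus_pos a c Ha Hc)) as N2.
    field; easy.
  - easy.
  - intros v u Hv Hu; unfold beta_ratio; simpl poch; simpl INR; rewrite Cplus_0_r.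
    replace (1 / 1 * beta_int a c (v, u))%C with (beta_int a c (v, u)) by field.
    apply HK; easy.
  - intros n; apply lim01_beta_ratio; easy.
Qed.

(** * Application to the hypergeometric series *)

Lemma poch_list_app (l l' : list C) (n : nat) :
  poch_list (l ++ l') n = (poch_list l n * poch_list l' n)%C.
Proof.
  unfold poch_list; induction l as [|a l IH]; simpl; [ring | rewrite IH; ring].
Qed.

Lemma poch_list_neq0 (l : list C) (n : nat) :
  (forall b, In b l -> ~ nonpos_int b) -> poch_list l n <> 0.
Proof.
  intros Hl; unfold poch_list; induction l as [|b l IH]; simpl.
  - intros H; apply RtoC_inj in H; lra.
  - apply Cmult_neq_0; [| apply IH; intros b' Hb'; apply Hl; right; easy].
    clear IH; induction n as [|n IH]; simpl; [intros H; apply RtoC_inj in H; lra |].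
    apply Cmult_neq_0; [easy |]; intros H.
    apply (Hl b (or_introl eq_refl)); exists n.
    rewrite RtoC_opp; replace b with ((b + INR n) - INR n)%C by ring; rewrite H; ring.
Qed.

Lemma CSeries_ext (a b : nat -> C) : (forall n, a n = b n) -> CSeries a = CSeries b.
Proof.
  intros H; unfold CSeries; f_equal; apply Series_ext; intros n; rewrite H; easy.
Qed.

Theorem theorem2 :
  forall (alpha1 : C) (alphas betas : list C) (beta gamma : C)
         (x : R) (p z : C),
  (forall b : C, In b betas -> ~ nonpos_int b) ->
  ~ nonpos_int gamma ->
  0 <= x ->
  (0 < Re p \/ p = RtoC 0) ->
  0 < Re beta < Re gamma ->
  ex_CSeries (hyp_term alpha1 x p (alphas ++ beta :: nil) (betas ++ gamma :: nil) z) ->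
  (forall t : R, 0 < t < 1 ->
     ex_CSeries (hyp_term alpha1 x p alphas betas (z * RtoC t)%C)) ->
  let integrand := fun t : R =>
    (Rcpow t (beta - RtoC 1) * Rcpow (1 - t) (gamma - beta - RtoC 1)
     * hyp_Gamma alpha1 x p alphas betas (z * RtoC t))%C in
  ex_CInt integrand (at_right 0) (at_left 1) /\
  hyp_Gamma alpha1 x p (alphas ++ beta :: nil) (betas ++ gamma :: nil) z
  = (/ CBeta beta (gamma - beta) * CInt integrand (at_right 0) (at_left 1))%C.
Proof.
  intros alpha1 alphas betas beta gamma x p z Hbetas _ _ _ [Hbeta Hgamma] Hleft Hright integrand.
  set (b := hyp_term alpha1 x p alphas betas z).
  set (c := (gamma - beta)%C).
  assert (Hc : 0 < Re c) by (unfold c, Re in *; simpl in *; lra).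
  assert (Hgc : (beta + c)%C = gamma) by (unfold c; ring).
  assert (Et : forall t n, hyp_term alpha1 x p alphas betas (z * RtoC t)%C n
    = (b n * RtoC (t ^ n))%C).
  { intros t n; unfold b, hyp_term; rewrite Cpow_mult_l, RtoC_pow; unfold Cdiv; ring. }
  assert (El : forall n,
    hyp_term alpha1 x p (alphas ++ beta :: nil) (betas ++ gamma :: nil) z n
    = (b n * (poch beta n / poch (beta + c) n))%C).
  { intros n; unfold b, hyp_term; rewrite !poch_list_app, Hgc.
    pose proof (poch_list_neq0 betas n Hbetas) as N1.
    assert (N2 : poch gamma n <> 0) by (apply poch_neq0; lra).
    assert (N3 : RtoC (INR (fact n)) <> 0)
      by (intros H; apply RtoC_inj in H; apply (INR_fact_neq_0 n H)).
    (* Occurrences 2 and 4 are those of the singleton lists of [beta] and [gamma]; the other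
       products stay opaque for [field]. *)
    unfold poch_list at 2 4; simpl; field; easy. }
  assert (Eint : forall t, (beta_ker beta c t * CSeries (fun n => b n * RtoC (t ^ n)))%C
    = integrand t).
  { intros t; unfold integrand, hyp_Gamma.
    rewrite (CSeries_ext (hyp_term alpha1 x p alphas betas (z * t)%C) _ (Et t)); easy. }
  assert (Hint : is_RInt_gen (V := CRN) integrand (at_right 0) (at_left 1)
    (CBeta beta c * CSeries (fun n => b n * (poch beta n / poch (beta + c) n)))%C).
  { apply (is_RInt_gen_ext (V := CRN)
      (fun t => beta_ker beta c t * CSeries (fun n => b n * RtoC (t ^ n)))%C).
    - apply filter_forall; intros y t _; apply Eint.
    - apply beta_integral_power_series; [easy | easy | |].
      + intros t Ht; apply (ex_series_ext (V := CRN) _ _ (Et t)), Hright; easy.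
      + apply (ex_series_ext (V := CRN) _ _ El), Hleft. }
  split; [eexists; apply Hint |].
  unfold CInt; rewrite (is_RInt_gen_unique (V := CRC) _ _ Hint).
  unfold hyp_Gamma; rewrite (CSeries_ext _ _ El); fold c.
  (* Since [/ 0] is 0, a zero of B would make the right side vanish; nonvanishing is what allows the
     factor to be cancelled. *)
  pose proof (CBeta_neq0 beta c Hbeta Hc) as N0; field; easy.
Qed.
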